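(* Let $A\subseteq\mathcal B(H)$ be the $C^*$-algebra constructed in the context (for any choice of the data described there). Every nonzero irreducible representation $\rho:A\to\mathcal B(K)$ on a Hilbert space $K$ is unitarily equivalent to the inclusion $A\subseteq\mathcal B(H)$.
   Context: Conventions. Algebras and Hilbert spaces are complex; inner products are linear in the first variable; for vectors $x,y$, $\theta_{x,y}z=\langle z,y\rangle x$. A representation is a $*$-homomorphism into $\mathcal B(K)$; no separability of $K$ is assumed. Strong limits are limits in the strong operator topology. CAR algebra. $C=\overline{\bigcup_{n\ge0}C_n}$ with $C_n=M_2(\mathbb C)^{\otimes n}$ embedded in $C_{n+1}$ by $a\mapsto a\otimes1_2$. Its unique tracial state is $\tau(a)=2^{-n}\operatorname{Tr}(a)$, $a\in C_n$. Let $e_{00}\in M_2(\mathbb C)$ be the first diagonal matrix unit, $q_n=e_{00}^{\otimes n}\in C$ (so $q_0=1$ and $q_n$ is decreasing), and let $\phi_{\mathrm r}$ be the pure product state of $C$ selecting the first coordinate in each tensor factor, i.e. the product of the vector states $a\mapsto a_{00}$ on $M_2(\mathbb C)$. Pure-state data. Choose pure states $(\phi_i)_{i\in I}$ of $C$, with GNS triples $(H_i,\pi_i,\xi_i)$, such that $(\pi_i)_{i\in I}$ contains exactly one representative of each unitary equivalence class of irreducible representations of $C$, with a distinguished index $\mathrm r\in I$ corresponding to $\phi_{\mathrm r}$. For each $i\in I$ choose an automorphism $\alpha_i$ of $C$ with $\phi_i\circ\alpha_i=\phi_{\mathrm r}$ and $\alpha_{\mathrm r}=\mathrm{id}_C$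 which is asymptotically inner: there is a norm-continuous path $t\mapsto u_{i,t}$ ($t\ge0$) of unitaries of $C$ with $u_{i,0}=1$ and $\lim_{t\to\infty}\|\alpha_i(a)-u_{i,t}au_{i,t}^*\|=0$ for all $a\in C$. (Such $\alpha_i$ exist by the Kishimoto–Ozawa–Sakai homogeneity theorem.) Put, for $n\ge0$, $p_{i,n}=\alpha_i(q_n)$, $f_n=q_n-q_{n+1}$, $e_{i,n}=p_{i,n}-p_{i,n+1}$. Choose $w_{i,n}\in C$ with $w_{i,n}^*w_{i,n}=e_{i,n}$, $w_{i,n}w_{i,n}^*=f_n$, $w_{\mathrm r,n}=f_n$ (such elements exist), and put $s_{i,N}=\sum_{n=0}^{N-1}w_{i,n}\in C$. The algebra. Let $H=\bigoplus_{i\in I}H_i$, $\Pi=\bigoplus_{i\in I}\pi_i:C\to\mathcal B(H)$, and let $\zeta_i\in H$ be the image of $\xi_i$ under the coordinate inclusion $H_i\to H$. Let $S_i$ be the strong limit of $\Pi(s_{i,N})$ as $N\to\infty$ (which exists) and $L_i=S_i+\theta_{\zeta_{\mathrm r},\zeta_i}$, which is a unitary on $H$. Define $A=C^*(\Pi(C),\{L_i:i\in I\})\subseteq\mathcal B(H)$, and $j:C\to A$, $j(a)=\Pi(a)$. *)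

(* Defs.v *)
From HB Require Import structures.
From mathcomp Require Import all_boot all_order all_algebra.
From mathcomp Require Import complex mxtens.
From mathcomp Require Import all_classical all_reals all_analysis.

Set Implicit Arguments.
Unset Strict Implicit.
Unset Printing Implicit Defensive.

Import Order.TTheory GRing.Theory Num.Theory.
Import numFieldNormedType.Exports.

Local Open Scope classical_set_scope.
Local Open Scope ring_scope.
Local Open Scope complex_scope.
Local Open Scope sesquilinear_scope.

(* Throughout, the complex numbers are R[i] for R : realType.  A norm on an
   R[i]-module takes its values in R[i]; in the order of R[i], an inequality
   0 <= z says that z is real and nonnegative. *)

(* The product is a field of this mixin because the norm structures of the
   library have no join with its ring structures. *)
HB.mixin Record isCStarAlgebra (R : realType) A
    of CompleteNormedModule R[i] A := {
  cmul : A -> A -> A ;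
  cone : A ;
  star : A -> A ;
  cmulA : associative cmul ;
  cmul1a : left_id cone cmul ;
  cmula1 : right_id cone cmul ;
  cmulDl : left_distributive cmul +%R ;
  cmulDr : right_distributive cmul +%R ;
  cmulZl : forall (c : R[i]) (a b : A), cmul (c *: a) b = c *: cmul a b ;
  cmulZr : forall (c : R[i]) (a b : A), cmul a (c *: b) = c *: cmul a b ;
  starD : {morph star : a b / a + b} ;
  starZ : forall (c : R[i]) (a : A), star (c *: a) = c^*%C *: star a ;
  starM : forall a b : A, star (cmul a b) = cmul (star b) (star a) ;
  starK : involutive star ;
  cone_neq0 : cone != 0 ;
  norm_cmul_le : forall a b : A, `|cmul a b| <= `|a| * `|b| ;
  norm_star_cmul : forall a : A, `|cmul (star a) a| = `|a| ^+ 2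
}.

#[short(type="cstarAlgType")]
HB.structure Definition CStarAlgebra (R : realType) :=
  { A of CompleteNormedModule R[i] A & isCStarAlgebra R A }.

Notation "a ** b" := (cmul a b) (at level 40, left associativity).

HB.mixin Record isHilbert (R : realType) H of CompleteNormedModule R[i] H := {
  dot : H -> H -> R[i] ;
  dotDl : forall x y z : H, dot (x + y) z = dot x z + dot y z ;
  dotZl : forall (c : R[i]) (x y : H), dot (c *: x) y = c * dot x y ;
  dotC : forall x y : H, dot y x = (dot x y)^*%C ;
  dot_norm : forall x : H, dot x x = `|x| ^+ 2
}.

#[short(type="hilbertType")]
HB.structure Definition Hilbert (R : realType) :=
  { H of CompleteNormedModule R[i] H & isHilbert R H }.

(* B(H) is represented as a set of bare functions H -> H. *)
Definition bounded_operator (R : realType) (H : hilbertType R) (T : H -> H) :=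
  linear T /\ exists M : R[i], forall x, `|T x| <= M * `|x|.

Definition adjoint (R : realType) (H : hilbertType R) (T S : H -> H) :=
  forall x y, dot (T x) y = dot x (S y).

Definition unitary_operator (R : realType) (H K : hilbertType R)
    (U : H -> K) :=
  [/\ linear U, forall x y, dot (U x) (U y) = dot x y & range U = setT].

Definition theta (R : realType) (H : hilbertType R) (x y : H) : H -> H :=
  fun z => dot z y *: x.

(* The last clause is closedness for the operator norm:
   `|T x - S x| <= e * `|x| for all x means that ||T - S|| <= e. *)
Record cstar_subalgebra (R : realType) (H : hilbertType R)
    (B : set (H -> H)) : Prop := {
  csub_bounded : forall T, B T -> bounded_operator T ;
  csub0 : B (fun=> 0) ;
  csubD : forall S T, B S -> B T -> B (fun x => S x + T x) ;
  csubZ : forall (c : R[i]) T, B T -> B (fun x => c *: T x) ;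
  csubM : forall S T, B S -> B T -> B (S \o T) ;
  csub_adjoint : forall S T,
    bounded_operator T -> B S -> adjoint S T -> B T ;
  csub_closed : forall T, bounded_operator T ->
    (forall e : R[i], 0 < e ->
      exists2 S, B S & forall x, `|T x - S x| <= e * `|x|) -> B T
}.

Definition cstar_generated (R : realType) (H : hilbertType R)
    (G : set (H -> H)) : set (H -> H) :=
  smallest (@cstar_subalgebra R H) G.

Record representation (R : realType) (C : cstarAlgType R) (K : hilbertType R)
    (rho : C -> K -> K) : Prop := {
  rep_bounded : forall a, bounded_operator (rho a) ;
  repD : forall a b x, rho (a + b) x = rho a x + rho b x ;
  repZ : forall (c : R[i]) a x, rho (c *: a) x = c *: rho a x ;
  repM : forall a b x, rho (a ** b) x = rho a (rho b x) ;
  rep_star : forall a, adjoint (rho a) (rho (star a))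
}.

(* Representations of an operator algebra B: only the values of rho on B
   matter. *)
Record op_representation (R : realType) (H : hilbertType R)
    (B : set (H -> H)) (K : hilbertType R)
    (rho : (H -> H) -> (K -> K)) : Prop := {
  oprep_bounded : forall T, B T -> bounded_operator (rho T) ;
  oprepD : forall S T, B S -> B T ->
    forall x, rho (fun y => S y + T y) x = rho S x + rho T x ;
  oprepZ : forall (c : R[i]) T, B T ->
    forall x, rho (fun y => c *: T y) x = c *: rho T x ;
  oprepM : forall S T, B S -> B T ->
    forall x, rho (S \o T) x = rho S (rho T x) ;
  oprep_adjoint : forall S T, B S -> B T -> adjoint S T ->
    adjoint (rho S) (rho T)
}.

(* The next three notions concern families of operators (rho a) indexed by the
   elements a of a set D: D = setT for representations of a C*-algebra, and
   D = B for those of an algebra B of operators. *)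
Definition nonzero_rep (R : realType) (X : Type) (D : set X)
    (K : hilbertType R) (rho : X -> K -> K) :=
  exists a x, D a /\ rho a x != 0.

Definition irreducible_rep (R : realType) (X : Type) (D : set X)
    (K : hilbertType R) (rho : X -> K -> K) :=
  forall V : set K,
    closed V -> V 0 ->
    (forall (c : R[i]) x y, V x -> V y -> V (c *: x + y)) ->
    (forall a x, D a -> V x -> V (rho a x)) ->
    V = [set 0] \/ V = setT.

Definition unitarily_equivalent (R : realType) (X : Type) (D : set X)
    (H K : hilbertType R) (rho : X -> H -> H) (sigma : X -> K -> K) :=
  exists2 U : H -> K, unitary_operator U &
    forall a x, D a -> U (rho a x) = sigma a (U x).

Definition state (R : realType) (C : cstarAlgType R) (phi : C -> R[i]) :=
  [/\ forall a b, phi (a + b) = phi a + phi b,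
      forall (c : R[i]) a, phi (c *: a) = c * phi a,
      forall a, 0 <= phi (star a ** a) &
      phi (cone : C) = 1].

Definition pure_state (R : realType) (C : cstarAlgType R) (phi : C -> R[i]) :=
  state phi /\
  forall (psi1 psi2 : C -> R[i]) (t : R), state psi1 -> state psi2 ->
    0 < t < 1 ->
    (forall a, phi a = t%:C * psi1 a + (1 - t)%:C * psi2 a) ->
    psi1 = phi /\ psi2 = phi.

Definition GNS_triple (R : realType) (C : cstarAlgType R) (phi : C -> R[i])
    (K : hilbertType R) (pi : C -> K -> K) (xi : K) :=
  [/\ representation pi, dense (range (pi^~ xi)) &
      forall a, phi a = dot (pi a xi) xi].

Definition automorphism (R : realType) (C : cstarAlgType R) (al : C -> C) :=
  [/\ linear al, {morph al : a b / a ** b}, {morph al : a / star a} &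
      bijective al].

Definition unitary_elt (R : realType) (C : cstarAlgType R) (u : C) :=
  star u ** u = cone /\ u ** star u = cone.

Definition asymptotically_inner (R : realType) (C : cstarAlgType R)
    (al : C -> C) :=
  exists u : R -> C,
    [/\ {within [set t : R | 0 <= t], continuous u},
        forall t, 0 <= t -> unitary_elt (u t),
        u 0 = cone &
        forall a, u t ** a ** star (u t) @[t --> +oo] --> al a].

(* The order of the matrices of M_2^{(x) n}; the recursion makes
   A *t B : 'M_(dimC n.+1) well typed for A : 'M_(dimC n) and B : 'M_2. *)
Fixpoint dimC (n : nat) : nat := if n is m.+1 then (dimC m * 2)%N else 1%N.

(* C is the closure of the union of the increasing sequence of the
   M_2^{(x) n}, embedded by the iota n compatibly with a |-> a (x) 1_2. *)
Record CAR_algebra (R : realType) (C : cstarAlgType R)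
    (iota : forall n, 'M[R[i]]_(dimC n) -> C) : Prop := {
  car_linear : forall n, linear (iota n) ;
  carM : forall n (a b : 'M[R[i]]_(dimC n)),
    iota n (a *m b) = iota n a ** iota n b ;
  car1 : forall n, iota n 1%:M = cone ;
  car_star : forall n (a : 'M[R[i]]_(dimC n)), iota n (a ^t*) = star (iota n a) ;
  car_inj : forall n, injective (iota n) ;
  car_compat : forall n (a : 'M[R[i]]_(dimC n)),
    iota n.+1 (tensmx a (1%:M : 'M[R[i]]_2)) = iota n a ;
  car_dense : dense (\bigcup_n range (iota n))
}.

(* The elementary tensor a 0 (x) ... (x) a n.-1. *)
Fixpoint elem_tens (R : realType) (a : nat -> 'M[R[i]]_2) (n : nat) :
    'M[R[i]]_(dimC n) :=
  if n is m.+1 then tensmx (elem_tens a m) (a m) else 1%:M.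

Definition e00 (R : realType) : 'M[R[i]]_2 := delta_mx ord0 ord0.

Definition q_proj (R : realType) (C : cstarAlgType R)
    (iota : forall n, 'M[R[i]]_(dimC n) -> C) (n : nat) : C :=
  iota n (elem_tens (fun=> e00 R) n).

Definition f_proj (R : realType) (C : cstarAlgType R)
    (iota : forall n, 'M[R[i]]_(dimC n) -> C) (n : nat) : C :=
  q_proj iota n - q_proj iota n.+1.

(* phi is the product of the vector states a |-> a_{00} of M_2. *)
Definition first_coordinate_state (R : realType) (C : cstarAlgType R)
    (iota : forall n, 'M[R[i]]_(dimC n) -> C) (phi : C -> R[i]) :=
  state phi /\
  forall n (a : nat -> 'M[R[i]]_2),
    phi (iota n (elem_tens a n)) = \prod_(k < n) a k ord0 ord0.

(* H is the Hilbert direct sum of the Hs i, up to the unitary identification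
   that sends inc i to the i-th coordinate inclusion. *)
Record hilbert_sum (R : realType) (I : Type) (Hs : I -> hilbertType R)
    (H : hilbertType R) (inc : forall i, Hs i -> H) : Prop := {
  hsum_linear : forall i, linear (inc i) ;
  hsum_dot : forall i x y, dot (inc i x) (inc i y) = dot x y ;
  hsum_orth : forall i j x y, i <> j -> dot (inc i x) (inc j y) = 0 ;
  hsum_dense : dense [set h | exists (n : nat) (s : 'I_n -> I)
    (x : forall k, Hs (s k)), h = \sum_(k < n) inc (s k) (x k)]
}.

(* T is the operator (+)_i Ts i; being bounded, it is determined by its values
   on the summands. *)
Definition operator_sum (R : realType) (I : Type) (Hs : I -> hilbertType R)
    (H : hilbertType R) (inc : forall i, Hs i -> H)
    (Ts : forall i, Hs i -> Hs i) (T : H -> H) :=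
  bounded_operator T /\ forall i x, T (inc i x) = inc i (Ts i x).

Definition s_elt (R : realType) (C : cstarAlgType R) (w : nat -> C)
    (N : nat) : C := \sum_(n < N) w n.

Definition strong_lim (R : realType) (H : hilbertType R) (T : nat -> H -> H) :
    H -> H := fun x => lim (T N x @[N --> \oo]).

Definition L_op (R : realType) (C : cstarAlgType R) (H : hilbertType R)
    (Pi : C -> H -> H) (w : nat -> C) (zeta_r zeta : H) : H -> H :=
  fun x => strong_lim (fun N => Pi (s_elt w N)) x + theta zeta_r zeta x.

(* Main.v *)
Require Import Defs.
From mathcomp Require Import all_boot all_order all_algebra.
From mathcomp Require Import complex mxtens.
From mathcomp Require Import all_classical all_reals all_analysis.
From mathcomp Require Import ring lra.

Set Implicit Arguments.
Unset Strict Implicit.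
Unset Printing Implicit Defensive.

Import Order.TTheory GRing.Theory Num.Theory.
Import numFieldNormedType.Exports.

Local Open Scope classical_set_scope.
Local Open Scope ring_scope.
Local Open Scope complex_scope.

(** Let rho be irreducible on K and put sg = rho o Pi, a representation of C.
For each i let K_i be the space of vectors of K fixed by all sg (p_(i,n)).  The
proof turns on whether all the K_i vanish.

The projections q_n excise phi_r: q_n a q_n = phi_r(a) q_n for a in C_m, n >= m.
Transporting this by alpha_i, one finds that <sg(a) x, y> = phi_i(a) <x, y> for
x, y in K_i, in every unital representation (automorphism_excision).  Hence a
unit vector of K_i generates a copy of pi_i; in pi_i itself the fixed space is
the line of xi_i (fixed_line), pi_i is irreducible (gns_irreducible), and the
p_(j,n) with j different from i have no fixed vector in it (fixed_other).  On H
this makes the fixed space of the p_(i,n) the line of zeta_i (Pi_fixed_line), so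
that L_i is a unitary determined by two relations, L_i Pi(1 - p_(i,N)) =
Pi(s_(i,N)) and L_i zeta_i = zeta_r; the first of them passes to rho.

Suppose that all K_i vanish.  Then sg(p_(i,N)) tends strongly to 0, so rho(L_i)
is the strong limit of the sg(s_(i,N)), and the adjoint of rho(L_i) is that of
their adjoints.  Subspaces invariant under C are then invariant under A, so sg is
irreducible and equivalent to some pi_i.  But xi_i is a fixed vector of pi_i: a
contradiction.

So some K_j contains a unit vector.  The unitaries rho(L_i) map K_i onto K_r, so
there are unit vectors eta_i in K_i, all sent by rho(L_i) to eta_r.  By excision
and fixed_orthogonal the vectors sg(a) eta_i and Pi(a) zeta_i have the same Gram
matrix, which gives an isometry W from H to K with W Pi(a) zeta_i = sg(a) eta_i.
It intertwines C by construction and L_i with rho(L_i) by the two relations,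
hence all of A.  Its range is closed, nonzero and invariant, so it is K.

The last two steps use limits of operators, which rho must preserve: no
continuity is assumed of representations, so their contractivity is proved first,
from Neumann series (nm_le_of_resolvent, rep_contractive, oprep_contractive). *)

(** * Real-valued norms *)

Section RealNorm.
Variables (R : realType) (V : normedZmodType R[i]).
Implicit Types x y z : V.

(** The library norm of an R[i]-module lives in R[i]; its real part lives in R,
    where the order is total and suprema exist. *)
Definition nm x : R := complex.Re `|x|.

Lemma nmE x : `|x| = (nm x)%:C.
Proof.
have: 0 <= `|x| by [].
rewrite /nm; case: (`|x|) => a b; rewrite lecE /= => /andP[/eqP -> _].
by [].
Qed.

Lemma nm_ge0 x : 0 <= nm x.
Proof. by rewrite -ler0c -nmE. Qed.

Lemma nm0 : nm (0 : V) = 0.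
Proof. by rewrite /nm normr0. Qed.

Lemma nm_eq0 x : (nm x == 0) = (x == 0).
Proof. by rewrite -[x == 0]normr_eq0 nmE eq_complex /= eqxx andbT. Qed.

Lemma nmN x : nm (- x) = nm x.
Proof. by rewrite /nm normrN. Qed.

Lemma nm_distC x y : nm (x - y) = nm (y - x).
Proof. by rewrite /nm distrC. Qed.

Lemma nmD x y : nm (x + y) <= nm x + nm y.
Proof. by rewrite -lecR rmorphD /= -!nmE ler_normD. Qed.

Lemma nm_dist z x y : nm (x - y) <= nm (x - z) + nm (z - y).
Proof. by have := nmD (x - z) (z - y); rewrite addrA subrK. Qed.

Lemma nm_small x : (forall e : R, 0 < e -> nm x < e) -> x = 0.
Proof.
move=> h; apply/eqP; rewrite -nm_eq0; apply/negPn/negP => n0.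
have := h (nm x); rewrite ltxx lt_neqAle nm_ge0 eq_sym n0.
by move/(_ isT).
Qed.

End RealNorm.

Lemma nmZ (R : realType) (V : normedModType R[i]) (c : R[i]) (x : V) :
  nm (c *: x) = nm c * nm x.
Proof.
have: `|c *: x| = `|c| * `|x| by rewrite normrZ.
by rewrite !nmE -rmorphM /= => /eqP; rewrite eq_complex /= eqxx andbT => /eqP.
Qed.

Section NormC.
Variable (R : realType).
Implicit Types c d : R[i].

Lemma nmM c d : nm (c * d) = nm c * nm d.
Proof.
have: `|c * d| = `|c| * `|d| by rewrite normrM.
by rewrite !nmE -rmorphM /= => /eqP; rewrite eq_complex /= eqxx andbT => /eqP.
Qed.

Lemma nm_real (a : R) : nm (a%:C : R[i]) = `|a|.
Proof. by rewrite /nm normc_def /= expr0n /= addr0 sqrtr_sqr. Qed.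

Lemma Re_le_nm c : complex.Re c <= nm c.
Proof. by rewrite -lecR -nmE (le_trans _ (normc_ge_Re _))// lecR ler_norm. Qed.

Lemma real_gt0 (e : R[i]) : 0 < e -> exists2 d : R, 0 < d & e = d%:C.
Proof.
case: e => a b; rewrite ltcE /= => /andP[/eqP -> a0].
by exists a.
Qed.

End NormC.

(** * Convergent sequences *)

(** Stated with real epsilons and for bare normed groups, so that it applies to
    vectors, to elements of a C*-algebra and to scalars of R[i] alike. *)
Definition tends (R : realType) (V : normedZmodType R[i])
    (u : nat -> V) (l : V) :=
  forall e : R, 0 < e ->
    exists N : nat, forall n, (N <= n)%N -> nm (u n - l) < e.

Section Tends.
Variables (R : realType) (V : normedZmodType R[i]).
Implicit Types (u v : nat -> V) (l m : V).

Lemma tends_const l : tends (fun=> l) l.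
Proof. by move=> e e0; exists 0%N => n _; rewrite subrr nm0. Qed.

Lemma tends_lipschitz (W : normedZmodType R[i]) (k : R) (u : nat -> V) (l : V)
    (v : nat -> W) (m : W) :
  (forall n, nm (v n - m) <= k * nm (u n - l)) -> tends u l -> tends v m.
Proof.
move=> h ul e e0.
have k0 : 0 < `|k| + 1 by rewrite ltr_wpDl.
have [|N hN] := ul (e / (`|k| + 1)); first by rewrite divr_gt0.
exists N => n /hN; rewrite ltr_pdivlMr // mulrC => hn.
apply: le_lt_trans (h n) _; apply: le_lt_trans hn.
by rewrite ler_wpM2r ?nm_ge0// (le_trans (ler_norm _))// lerDl.
Qed.

Lemma tendsD u v l m : tends u l -> tends v m ->
  tends (fun n => u n + v n) (l + m).
Proof.
move=> ul vm e e0; have e2 : 0 < e / 2 by rewrite divr_gt0.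
have [N hN] := ul _ e2; have [M hM] := vm _ e2.
exists (maxn N M) => n; rewrite geq_max => /andP[/hN a /hM b].
by rewrite opprD addrACA (le_lt_trans (nmD _ _))// (splitr e) ltrD.
Qed.

Lemma tendsN u l : tends u l -> tends (fun n => - u n) (- l).
Proof.
by apply: (tends_lipschitz (k := 1)) => n; rewrite mul1r -opprD nmN.
Qed.

Lemma tendsB u v l m : tends u l -> tends v m ->
  tends (fun n => u n - v n) (l - m).
Proof. by move=> ul /tendsN; apply: tendsD. Qed.

Lemma tends_uniq u l m : tends u l -> tends u m -> l = m.
Proof.
move=> ul um; apply/eqP; rewrite -subr_eq0; apply/eqP/nm_small => e e0.
have := tendsB um ul; rewrite /tends => /(_ _ e0)[N /(_ N (leqnn _))].
by rewrite subrr sub0r nmN nm_distC.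
Qed.

Lemma tends_eventually u v l N :
  (forall n, (N <= n)%N -> u n = v n) -> tends u l -> tends v l.
Proof.
move=> uv ul e /ul[M hM]; exists (maxn N M) => n; rewrite geq_max.
by move=> /andP[/uv <- /hM].
Qed.

Lemma tends_nm_le u l (b : R) : tends u l -> (forall n, nm (u n) <= b) ->
  nm l <= b.
Proof.
move=> ul h; apply/ler_addgt0Pr => e /ul[N /(_ N (leqnn _)) hN].
rewrite -(subrK (u N) l); apply: le_trans (nmD _ _) _.
by rewrite addrC lerD// nm_distC ltW.
Qed.

End Tends.

Lemma harmonic_small (R : realType) (e : R) : 0 < e ->
  exists N : nat, forall n, (N <= n)%N -> n.+1%:R^-1 < e.
Proof.
move=> e0; exists (Num.truncn e^-1) => n Nn.
rewrite -[X in _ < X]invrK ltf_pV2 ?posrE ?invr_gt0//.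
by rewrite (lt_le_trans (truncnS_gt _))// ler_nat.
Qed.

Lemma tends_harmonic (R : realType) (V : normedZmodType R[i]) (u : nat -> V) l
    (b : R) : 0 <= b -> (forall n, nm (u n - l) <= n.+1%:R^-1 * b) -> tends u l.
Proof.
move=> b0 h e e0.
have [|N hN] := @harmonic_small _ (e / (b + 1)).
  by rewrite divr_gt0// ltr_wpDl.
exists N => n /hN; rewrite ltr_pdivlMr ?ltr_wpDl// => hn.
by rewrite (le_lt_trans (h n))// (le_lt_trans _ hn)// ler_wpM2l// lerDl.
Qed.

Lemma tendsZ (R : realType) (V : normedModType R[i]) (u : nat -> V) l
    (c : R[i]) :
  tends u l -> tends (fun n => c *: u n) (c *: l).
Proof. by apply: (tends_lipschitz (k := nm c)) => n; rewrite -scalerBr nmZ. Qed.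

Section TendsTopology.
Variables (R : realType) (V : normedModType R[i]).
Implicit Types (u v : nat -> V) (l m : V).

Lemma tendsP u l : tends u l <-> u n @[n --> \oo] --> l.
Proof.
split=> [ul|/cvgrPdist_lt ul e e0].
- apply/cvgrPdist_lt => /= e /real_gt0[d /ul[N hN] ->].
  by exists N => // n /hN; rewrite nmE ltcR nm_distC.
- have [|N _ hN] := ul e%:C; first by rewrite ltcR.
  by exists N => n /hN; rewrite nmE ltcR nm_distC.
Qed.

Lemma tends_lim u l : tends u l -> lim (u n @[n --> \oo]) = l.
Proof. by move=> /tendsP; apply: cvg_lim; apply: norm_hausdorff. Qed.

Lemma closed_tends (S : set V) u l : closed S -> (forall n, S (u n)) ->
  tends u l -> S l.
Proof.
move=> cS Su /tendsP; apply: closed_cvg => //.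
exact: nearW.
Qed.

Lemma tends_closed (S : set V) :
  (forall u l, (forall n, S (u n)) -> tends u l -> S l) -> closed S.
Proof.
move=> h x cx.
have /choice[u hu] : forall n : nat, exists y, S y /\ nm (y - x) < n.+1%:R^-1.
  move=> n.
  have [|y [Sy]] := cx (ball x (n.+1%:R^-1)%:C).
    by apply: nbhsx_ballx; rewrite ltcR.
  by rewrite -ball_normE /= nmE ltcR nm_distC => ?; exists y.
apply: (h u) => [n|]; first by have [] := hu n.
apply: tends_harmonic ler01 _ => n.
by have [_ /ltW] := hu n; rewrite mulr1.
Qed.

Lemma dense_approx (S : set V) x (e : R) : dense S -> 0 < e ->
  exists2 s, S s & nm (x - s) < e.
Proof.
move=> dS e0; have [||y [yb Sy]] := dS (ball x e%:C).
- by exists x; apply: ballxx; rewrite ltcR.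
- by exact: ball_open.
- by exists y => //; move: yb; rewrite -ball_normE /= nmE ltcR.
Qed.

Lemma dense_seq (S : set V) x : dense S ->
  exists2 u : nat -> V, (forall n, S (u n)) & tends u x.
Proof.
move=> dS.
have /choice[u hu] : forall n : nat, exists y, S y /\ nm (x - y) < n.+1%:R^-1.
  by move=> n; have [|y ? ?] := @dense_approx S x n.+1%:R^-1 dS; [|exists y].
exists u => [n|]; first by have [] := hu n.
apply: tends_harmonic ler01 _ => n.
by have [_ /ltW] := hu n; rewrite mulr1 nm_distC.
Qed.

End TendsTopology.

Lemma dense_of_approx (R : realType) (V : normedModType R[i]) (S : set V) :
  (forall x (e : R), 0 < e -> exists2 s, S s & nm (x - s) < e) -> dense S.
Proof.
move=> h O [x Ox] oO.
have /nbhs_ballP[e /= /real_gt0[d d0 ->] hO] : nbhs x O by exact: open_nbhs_nbhs.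
have [s Ss xs] := h x d d0; exists s; split=> //; apply: hO.
by rewrite -ball_normE /= nmE ltcR.
Qed.

Lemma dense_sub (T : topologicalType) (S S' : set T) : S `<=` S' -> dense S ->
  dense S'.
Proof.
by move=> SS' dS O h1 h2; have [x [Ox /SS' Sx]] := dS O h1 h2; exists x.
Qed.

Lemma complete_tends (R : realType) (V : completeNormedModType R[i])
    (u : nat -> V) :
  (forall e : R, 0 < e -> exists N : nat, forall n, (N <= n)%N ->
     nm (u n - u N) < e) ->
  exists l, tends u l.
Proof.
move=> h; suff /cauchy_cvg/cvg_ex[l /tendsP ul] : cauchy (u n @[n --> \oo]).
  by exists l.
apply: cauchy_exP => e /real_gt0[d /h[N hN] ->].
exists (u N); exists N => // n /hN.
by rewrite -ball_normE /= nmE ltcR nm_distC.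
Qed.

(** * Linear maps and inner products *)

Section LinearMap.
Variables (R : realType) (U V : lmodType R[i]) (T : U -> V).
Hypothesis Tlin : linear T.

Lemma linD x y : T (x + y) = T x + T y.
Proof. by have := Tlin 1 x y; rewrite !scale1r. Qed.

Lemma lin0 : T 0 = 0.
Proof. by apply: (addIr (T 0)); rewrite -linD !add0r. Qed.

Lemma linZ c x : T (c *: x) = c *: T x.
Proof. by have := Tlin c x 0; rewrite lin0 !addr0. Qed.

Lemma linN x : T (- x) = - T x.
Proof. by rewrite -scaleN1r linZ scaleN1r. Qed.

Lemma linB x y : T (x - y) = T x - T y.
Proof. by rewrite linD linN. Qed.

End LinearMap.

Section Dot.
Variables (R : realType) (H : hilbertType R).
Implicit Types (x y z : H) (c : R[i]).

Lemma dotDr x y z : dot x (y + z) = dot x y + dot x z.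
Proof. by rewrite dotC dotDl rmorphD /= -!dotC. Qed.

Lemma dotZr c x y : dot x (c *: y) = c^*%C * dot x y.
Proof. by rewrite dotC dotZl rmorphM /= -dotC. Qed.

Lemma dot0l y : dot (0 : H) y = 0.
Proof. by have := dotZl 0 0 y; rewrite scaler0 mul0r. Qed.

Lemma dot0r x : dot x (0 : H) = 0.
Proof. by rewrite dotC dot0l conjc0. Qed.

Lemma dotNl x y : dot (- x) y = - dot x y.
Proof. by rewrite -scaleN1r dotZl mulN1r. Qed.

Lemma dotNr x y : dot x (- y) = - dot x y.
Proof. by rewrite dotC dotNl rmorphN /= -dotC. Qed.

Lemma dotBl x y z : dot (x - y) z = dot x z - dot y z.
Proof. by rewrite dotDl dotNl. Qed.

Lemma dotBr x y z : dot x (y - z) = dot x y - dot x z.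
Proof. by rewrite dotDr dotNr. Qed.

Lemma dot_suml (J : Type) (s : seq J) (F : J -> H) y :
  dot (\sum_(j <- s) F j) y = \sum_(j <- s) dot (F j) y.
Proof.
elim: s => [|j s IH]; first by rewrite !big_nil dot0l.
by rewrite !big_cons dotDl IH.
Qed.

Lemma dot_sumr (J : Type) (s : seq J) (F : J -> H) y :
  dot y (\sum_(j <- s) F j) = \sum_(j <- s) dot y (F j).
Proof.
elim: s => [|j s IH]; first by rewrite !big_nil dot0r.
by rewrite !big_cons dotDr IH.
Qed.

Lemma dot_nm x : dot x x = (nm x ^+ 2)%:C.
Proof. by rewrite dot_norm nmE rmorphXn. Qed.

Lemma nm_sq x : nm x ^+ 2 = complex.Re (dot x x).
Proof. by rewrite dot_nm. Qed.

Lemma nm_sqD x y :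
  nm (x + y) ^+ 2 = nm x ^+ 2 + 2 * complex.Re (dot x y) + nm y ^+ 2.
Proof.
rewrite !nm_sq dotDl !dotDr (dotC x y) !raddfD /=.
by case: (dot x y) => a b /=; ring.
Qed.

Lemma nm_sqB x y :
  nm (x - y) ^+ 2 = nm x ^+ 2 - 2 * complex.Re (dot x y) + nm y ^+ 2.
Proof. by rewrite nm_sqD nmN dotNr raddfN /=; ring. Qed.

Lemma nm_pythagoras x y : dot x y = 0 ->
  nm (x + y) ^+ 2 = nm x ^+ 2 + nm y ^+ 2.
Proof. by move=> xy; rewrite nm_sqD xy mulr0 addr0. Qed.

Lemma cauchy_schwarz x y : nm (dot x y) <= nm x * nm y.
Proof.
have [->|y0] := eqVneq y 0; first by rewrite dot0r !nm0 mulr0.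
have n0 : 0 < nm y by rewrite lt_neqAle eq_sym nm_eq0 y0 nm_ge0.
pose c := dot x y / (nm y ^+ 2)%:C.
have sq0 : (nm y ^+ 2)%:C != 0 :> R[i].
  by rewrite -(rmorph0 (real_complex R)) (inj_eq (@complexI R)) expf_neq0// gt_eqF.
have zy : dot (x - c *: y) (c *: y) = 0.
  by rewrite dotZr dotBl dotZl dot_nm /c divfK// subrr mulr0.
(* c *: y is the orthogonal projection of x on the line of y. *)
have := nm_pythagoras zy; rewrite subrK => e.
have : nm (c *: y) <= nm x.
  rewrite -(@ler_pXn2r _ 2) ?nnegrE ?nm_ge0// e lerDr sqr_ge0//.
have ec : nm (dot x y) = nm c * nm y ^+ 2.
  by rewrite -{1}[dot x y](divfK sq0) nmM nm_real (ger0_norm (sqr_ge0 _)).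
by rewrite nmZ ec expr2 mulrA => h; rewrite ler_wpM2r ?nm_ge0.
Qed.

Lemma dot_eq0 x : (forall y, dot x y = 0) -> x = 0.
Proof.
move=> h; apply/eqP; rewrite -nm_eq0 -sqrf_eq0.
by rewrite nm_sq h.
Qed.

Lemma dot_injl x y : (forall z, dot x z = dot y z) -> x = y.
Proof.
move=> h; apply/eqP; rewrite -subr_eq0; apply/eqP/dot_eq0 => z.
by rewrite dotBl h subrr.
Qed.

Lemma tends_dotl (u : nat -> H) l y : tends u l ->
  tends (fun n => dot (u n) y) (dot l y).
Proof.
by apply: (tends_lipschitz (k := nm y)) => n; rewrite -dotBl mulrC cauchy_schwarz.
Qed.

Lemma tends_dotr (u : nat -> H) l y : tends u l ->
  tends (fun n => dot y (u n)) (dot y l).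
Proof.
by apply: (tends_lipschitz (k := nm y)) => n; rewrite -dotBr cauchy_schwarz.
Qed.

Lemma dense_dot0 (S : set H) x : dense S -> (forall y, S y -> dot y x = 0) ->
  x = 0.
Proof.
move=> dS h; apply: dot_eq0 => y.
have [u uS uy] := dense_seq x dS.
have := tends_dotl x uy.
have -> : (fun n => dot (u n) x) = fun=> 0 by apply: funext => n; exact: h.
move=> /(tends_uniq (tends_const _)) e.
by apply/eqP; move/esym/eqP: e; rewrite dot_nm -(rmorph0 (real_complex R))
   (inj_eq (@complexI R)) expf_eq0 /= nm_eq0 => /eqP->; rewrite dot0l rmorph0.
Qed.

End Dot.

Lemma nm_eq_dot (R : realType) (H K : hilbertType R) (x : H) (y : K) :
  dot x x = dot y y -> nm x = nm y.
Proof.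
move=> e; apply/eqP; rewrite -(@eqrXn2 _ 2) ?nm_ge0//; apply/eqP.
by rewrite !nm_sq e.
Qed.

(** * Bounded operators *)

Section Bounded.
Variables (R : realType) (H : hilbertType R).
Implicit Types (T S : H -> H) (x y z : H).

Lemma bounded_nm T : bounded_operator T ->
  exists2 k : R, 0 <= k & forall x, nm (T x) <= k * nm x.
Proof.
move=> [_ [M hM]]; exists (nm M); first exact: nm_ge0.
move=> x; rewrite -lecR rmorphM /= -!nmE.
have h1 : 0 <= M * `|x| by apply: le_trans (hM x).
apply: le_trans (hM x) _.
by rewrite -[X in X <= _]ger0_norm// normrM normr_id.
Qed.

Lemma nm_bounded T (k : R) : linear T -> (forall x, nm (T x) <= k * nm x) ->
  bounded_operator T.
Proof.
move=> Tl hk; split=> //; exists k%:C => x.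
by rewrite !nmE -rmorphM /= lecR.
Qed.

Lemma bounded_tends T (u : nat -> H) l : bounded_operator T -> tends u l ->
  tends (fun n => T (u n)) (T l).
Proof.
move=> Tb; have [k _ hk] := bounded_nm Tb.
by apply: (tends_lipschitz (k := k)) => n; rewrite -(linB (proj1 Tb)).
Qed.

Lemma adjoint_sym T S : adjoint T S -> adjoint S T.
Proof. by move=> h x y; rewrite dotC -h -dotC. Qed.

Lemma adjoint_uniq T S S' : adjoint T S -> adjoint T S' -> S = S'.
Proof.
move=> h h'; apply: funext => x; apply: dot_injl => y.
by rewrite dotC -h h' -dotC.
Qed.

(** Spares a separate proof of linearity for adjoints built as pointwise
    limits. *)
Lemma adjoint_linear T S : adjoint T S -> linear T.
Proof.
move=> h c x y; apply: dot_injl => z.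
by rewrite h !dotDl !dotZl !h.
Qed.

Lemma adjoint_nm T S (k : R) : 0 <= k -> adjoint T S ->
  (forall x, nm (T x) <= k * nm x) -> forall x, nm (S x) <= k * nm x.
Proof.
move=> k0 h hk x.
have [n0|n0] := eqVneq (nm (S x)) 0; first by rewrite n0 mulr_ge0// nm_ge0.
have np : 0 < nm (S x) by rewrite lt_neqAle eq_sym n0 nm_ge0.
rewrite -(ler_pM2l np) -expr2 nm_sq -h (le_trans (Re_le_nm _))//.
apply: le_trans (cauchy_schwarz _ _) _.
by rewrite mulrCA mulrA ler_wpM2r ?nm_ge0// hk.
Qed.

End Bounded.

(** Quantitative form of the fact that |P|^2 lies in the spectrum of P*P, used
    to prove representations contractive.  If m is the least bound of |P|^2 and
    m > c^2, an inverse of m - P*P bounds |x|^2 by a multiple of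
    |(m - P*P) x|^2 <= m^2 |x|^2 - m |P x|^2,
    and solving for |P x|^2 improves the bound m.  Thus m <= c^2, that is,
    |P| <= c. *)
Lemma nm_le_of_resolvent (R : realType) (K : hilbertType R) (P P' : K -> K)
    (k c : R) :
  adjoint P P' -> (forall x, nm (P x) <= k * nm x) -> 0 <= k -> 0 <= c ->
  (forall mu : R, c ^+ 2 < mu ->
     exists q : R, forall x, nm x <= q * nm (mu%:C *: x - P' (P x))) ->
  forall x, nm (P x) <= c * nm x.
Proof.
move=> PP' hk k0 c0 hres.
have P0 : P 0 = 0 by apply: lin0; apply: adjoint_linear PP'.
pose D := [set m : R | 0 <= m /\ forall x, nm (P x) ^+ 2 <= m * nm x ^+ 2].
have Dk : D (k ^+ 2).
  split=> [|x]; first exact: sqr_ge0.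
  by rewrite -exprMn ler_pXn2r ?nnegrE ?mulr_ge0 ?nm_ge0.
have lbD : has_lbound D by exists 0 => m [].
pose m := inf D.
have m0 : 0 <= m by apply: lb_le_inf; [exists (k ^+ 2)|move=> ? []].
have Dm : D m.
  split=> // x; have [->|x0] := eqVneq x 0; first by rewrite P0 nm0 expr0n mulr0.
  have xp : 0 < nm x ^+ 2.
    by rewrite exprn_gt0// lt_neqAle eq_sym nm_eq0 x0 nm_ge0.
  rewrite -ler_pdivrMr//; apply: lb_le_inf; first by exists (k ^+ 2).
  by move=> d [_ /(_ x)]; rewrite ler_pdivrMr.
suff mc : m <= c ^+ 2.
  move=> x; rewrite -(@ler_pXn2r _ 2) ?nnegrE ?nm_ge0 ?mulr_ge0 ?nm_ge0// exprMn.
  by apply: le_trans (proj2 Dm x) _; rewrite ler_wpM2r ?sqr_ge0.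
rewrite leNgt; apply/negP => mc.
have mp : 0 < m by apply: le_lt_trans mc; rewrite sqr_ge0.
have [q0 hq0] := hres _ mc.
(* The bound given by the resolvent may be nonpositive, for instance when
   K = 0. *)
pose q := `|q0| + 1.
have qp : 0 < q by rewrite ltr_wpDl.
have hq x : nm x ^+ 2 <= q ^+ 2 * (m ^+ 2 * nm x ^+ 2 - m * nm (P x) ^+ 2).
  have : nm x <= q * nm (m%:C *: x - P' (P x)).
    apply: le_trans (hq0 x) _; rewrite ler_wpM2r ?nm_ge0//.
    by rewrite (le_trans (ler_norm _))// lerDl.
  rewrite -(@ler_pXn2r _ 2) ?nnegrE ?nm_ge0 ?mulr_ge0 ?nm_ge0 ?(ltW qp)// exprMn.
  move=> /le_trans; apply; rewrite ler_wpM2l ?sqr_ge0// nm_sqB.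
  rewrite nmZ nm_real ger0_norm// exprMn dotZl -(adjoint_sym (adjoint_sym PP')).
  rewrite dot_nm -rmorphM /=.
  have : nm (P' (P x)) ^+ 2 <= m * nm (P x) ^+ 2.
    have [sm0 sm] : 0 <= Num.sqrt m /\ Num.sqrt m ^+ 2 = m.
      by rewrite sqr_sqrtr// sqrtr_ge0.
    rewrite -{1}sm -exprMn ler_pXn2r ?nnegrE ?mulr_ge0 ?nm_ge0//.
    apply: (adjoint_nm sm0 PP') => y.
    rewrite -(@ler_pXn2r _ 2) ?nnegrE ?mulr_ge0 ?nm_ge0// exprMn sm.
    exact: (proj2 Dm).
  lra.
pose m' := m - (q ^+ 2 * m)^-1.
have m'm : m' < m by rewrite ltrBlDr ltrDl invr_gt0 mulr_gt0 // exprn_gt0.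
have Dm' : D (Num.max 0 m').
  split=> [|x]; first by rewrite le_max lexx.
  have : nm (P x) ^+ 2 <= m' * nm x ^+ 2.
    rewrite /m' mulrBl lerBrDr -lerBrDl.
    rewrite -ler_pdivlMl ?invr_gt0 ?mulr_gt0 ?exprn_gt0//.
    rewrite invrK; have := hq x; lra.
  by move/le_trans; apply; rewrite ler_wpM2r ?sqr_ge0// le_max lexx orbT.
have := ge_inf lbD Dm'; rewrite -/m leNgt => /negP; apply.
by rewrite gt_max mp.
Qed.

Lemma geometric_small (R : realType) (b q : R) : 0 <= b -> 0 <= q -> q < 1 ->
  forall e, 0 < e -> exists N : nat, q ^+ N * b < e.
Proof.
move=> b0 q0 q1 e e0.
have /cvgrPdist_lt/(_ (e / (b + 1))) : (q ^+ n) @[n --> \oo] --> (0 : R).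
  by apply: cvg_expr; rewrite ger0_norm.
rewrite divr_gt0 ?ltr_wpDl// => /(_ isT)[N _ /(_ N (leqnn _))] /=.
rewrite sub0r normrN ger0_norm ?exprn_ge0// ltr_pdivlMr ?ltr_wpDl// => h.
by exists N; apply: le_lt_trans h; rewrite ler_wpM2l ?exprn_ge0// lerDl.
Qed.

(** The equation x = y + T x is solved by iteration; its solution is the sum of
    the Neumann series of T at y. *)
Lemma neumann (R : realType) (V : completeNormedModType R[i]) (T : V -> V)
    (q : R) (y : V) :
  linear T -> 0 <= q < 1 -> (forall x, nm (T x) <= q * nm x) ->
  exists x, x = y + T x.
Proof.
move=> Tl /andP[q0 q1] hT.
pose u n := iter n (fun x => y + T x) 0.
have step n k : nm (u (n + k)%N - u n) <= q ^+ n * nm (u k).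
  elim: n => [|n IH]; first by rewrite add0n subr0 mul1r.
  rewrite addSn /u /= opprD addrACA subrr add0r -(linB Tl) exprS -mulrA.
  by apply: le_trans (hT _) _; rewrite ler_wpM2l.
have q1' : 0 < 1 - q by rewrite subr_gt0.
have ub k : nm (u k) <= nm y / (1 - q).
  elim: k => [|k IH]; first by rewrite nm0 divr_ge0 ?nm_ge0 ?ltW.
  apply: le_trans (nmD _ _) _.
  apply: le_trans (_ : nm y + q * (nm y / (1 - q)) <= _).
    by rewrite lerD2l (le_trans (hT _))// ler_wpM2l.
  suff -> : nm y + q * (nm y / (1 - q)) = nm y / (1 - q) by [].
  by field; rewrite gt_eqF.
set b := nm y / (1 - q) in ub.
have b0 : 0 <= b by apply: le_trans (ub 0%N); rewrite nm_ge0.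
have geo := geometric_small b0 q0 q1.
have [|l ul] := @complete_tends _ _ u.
  move=> e /geo[N hN]; exists N => n /subnK <-; rewrite addnC.
  apply: le_lt_trans (step _ _) _; apply: le_lt_trans hN.
  by rewrite ler_wpM2l ?exprn_ge0.
exists l; apply: (tends_uniq ul).
have : tends (fun n => y + T (u n)) (y + T l).
  apply: tendsD; first exact: tends_const.
  by apply: tends_lipschitz ul => n; rewrite -(linB Tl).
move=> h e /h[N hN]; exists N.+1 => -[//|n Nn]; exact: hN.
Qed.

(** * C*-algebras and their unital representations *)

Section CStar.
Variables (R : realType) (C : cstarAlgType R).
Implicit Types a b c : C.

Lemma nm_cmul a b : nm (a ** b) <= nm a * nm b.
Proof. by rewrite -lecR rmorphM /= -!nmE norm_cmul_le. Qed.

Lemma nm_star_cmul a : nm (star a ** a) = nm a ^+ 2.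
Proof.
have := norm_star_cmul a.
by rewrite !nmE -rmorphXn /= => /eqP; rewrite eq_complex /= eqxx andbT => /eqP.
Qed.

Lemma cstar_eq0 a : star a ** a = 0 -> a = 0.
Proof.
by move=> h; apply/eqP; rewrite -nm_eq0 -sqrf_eq0 -nm_star_cmul h nm0.
Qed.

Lemma cmul0a a : (0 : C) ** a = 0.
Proof. by have := cmulZl 0 0 a; rewrite !scale0r. Qed.

Lemma cmula0 a : a ** (0 : C) = 0.
Proof. by have := cmulZr 0 a 0; rewrite !scale0r. Qed.

Lemma cmulNl a b : (- a) ** b = - (a ** b).
Proof. by rewrite -scaleN1r cmulZl scaleN1r. Qed.

Lemma cmulNr a b : a ** (- b) = - (a ** b).
Proof. by rewrite -scaleN1r cmulZr scaleN1r. Qed.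

Lemma cmulBl a b c : (a - b) ** c = a ** c - b ** c.
Proof. by rewrite cmulDl cmulNl. Qed.

Lemma cmulBr a b c : a ** (b - c) = a ** b - a ** c.
Proof. by rewrite cmulDr cmulNr. Qed.

Lemma star_linN a : star (- a) = - star a.
Proof. by rewrite -scaleN1r starZ rmorphN rmorph1 scaleN1r. Qed.

Lemma starB a b : star (a - b) = star a - star b.
Proof. by rewrite starD star_linN. Qed.

Lemma star0 : star (0 : C) = 0.
Proof. by rewrite -[X in star X](subrr (cone : C)) starB subrr. Qed.

Lemma star1 : star (cone : C) = cone.
Proof. by rewrite -[LHS]cmul1a -[X in X ** _]starK -starM cmul1a starK. Qed.

Lemma cmul_suml (J : Type) (s : seq J) (F : J -> C) b :
  (\sum_(j <- s) F j) ** b = \sum_(j <- s) (F j ** b).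
Proof.
elim: s => [|j s IH]; first by rewrite !big_nil cmul0a.
by rewrite !big_cons cmulDl IH.
Qed.

Lemma star_sum (J : Type) (s : seq J) (F : J -> C) :
  star (\sum_(j <- s) F j) = \sum_(j <- s) star (F j).
Proof.
elim: s => [|j s IH]; first by rewrite !big_nil star0.
by rewrite !big_cons starD IH.
Qed.

End CStar.

Definition unital_rep (R : realType) (C : cstarAlgType R) (K : hilbertType R)
    (sg : C -> K -> K) :=
  representation sg /\ forall x, sg cone x = x.

Section Rep.
Variables (R : realType) (C : cstarAlgType R) (K : hilbertType R).
Variable sg : C -> K -> K.
Hypothesis sgr : unital_rep sg.
Let sgrep := proj1 sgr.

Lemma rep_lin a : linear (sg a).
Proof. exact: (proj1 (rep_bounded sgrep a)). Qed.

Lemma rep_linl x : linear (sg^~ x).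
Proof. by move=> c a b /=; rewrite (repD sgrep) (repZ sgrep). Qed.

(** Every mu > |a|^2 makes mu - a*a invertible in C, so the resolvent needed by
    nm_le_of_resolvent is the image of an element of C. *)
Lemma rep_contractive a x : nm (sg a x) <= nm a * nm x.
Proof.
have [k k0 hk] := bounded_nm (rep_bounded sgrep a).
apply: (nm_le_of_resolvent (rep_star sgrep a) hk k0 (nm_ge0 a)) => mu hmu.
have mu0 : 0 < mu by apply: le_lt_trans hmu; rewrite sqr_ge0.
pose b := (mu^-1)%:C *: (star a ** a).
have nb : nm b = nm a ^+ 2 / mu.
  by rewrite nmZ nm_real nm_star_cmul ger0_norm ?invr_ge0 ?ltW// mulrC.
have [||y|g hg] := @neumann _ _ (fun y => y ** b) (nm b) cone.
- by move=> c x1 y1 /=; rewrite cmulDl cmulZl.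
- by rewrite nm_ge0 nb ltr_pdivrMr// mul1r.
- by rewrite mulrC nm_cmul.
have [q q0 hq] := bounded_nm (rep_bounded sgrep g).
exists (q * mu^-1) => v.
have {1}<- : sg g ((mu^-1)%:C *: (mu%:C *: v - sg (star a) (sg a v))) = v.
  rewrite scalerBr scalerA -rmorphM /= mulVf ?gt_eqF// scale1r.
  rewrite -(repM sgrep) -(repZ sgrep) -/b (linB (rep_lin g)) -(repM sgrep).
  by rewrite -(linB (rep_linl v)) {1}hg addrK /= (proj2 sgr).
apply: le_trans (hq _) _.
by rewrite nmZ nm_real ger0_norm ?mulrA// invr_ge0 ltW.
Qed.

Lemma rep_tends (u : nat -> C) a x : tends u a ->
  tends (fun n => sg (u n) x) (sg a x).
Proof.
apply: (tends_lipschitz (k := nm x)) => n.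
by rewrite -(linB (rep_linl x)) mulrC rep_contractive.
Qed.

End Rep.

(** * Generated C*-algebras of operators *)

Section Generated.
Variables (R : realType) (H : hilbertType R).
Implicit Types (G B : set (H -> H)) (S T : H -> H).

Lemma bounded_cstar : cstar_subalgebra [set T : H -> H | bounded_operator T].
Proof.
split=> //=.
- by split=> [c x y|]; [rewrite scaler0 addr0|exists 0 => x; rewrite normr0 mul0r].
- move=> S T Sb Tb; have [k k0 hk] := bounded_nm Sb; have [l l0 hl] := bounded_nm Tb.
  apply: (@nm_bounded _ _ _ (k + l)) => [c x y|x].
    by rewrite (proj1 Sb) (proj1 Tb) scalerDr addrACA.
  by rewrite mulrDl (le_trans (nmD _ _))// lerD.
- move=> c T Tb; have [l l0 hl] := bounded_nm Tb.
  apply: (@nm_bounded _ _ _ (nm c * l)) => [d x y|x].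
    by rewrite (proj1 Tb) scalerDr !scalerA mulrC.
  by rewrite nmZ -mulrA ler_wpM2l// nm_ge0.
- move=> S T Sb Tb; have [k k0 hk] := bounded_nm Sb; have [l l0 hl] := bounded_nm Tb.
  apply: (@nm_bounded _ _ _ (k * l)) => [c x y|x] /=.
    by rewrite (proj1 Tb) (proj1 Sb).
  by rewrite -mulrA (le_trans (hk _))// ler_wpM2l.
Qed.

Lemma generated_cstar G : (forall T, G T -> bounded_operator T) ->
  cstar_subalgebra (cstar_generated G).
Proof.
move=> Gb; split.
- by move=> T; apply; split; [exact: bounded_cstar|exact: Gb].
- by move=> B [Bc _]; exact: csub0.
- by move=> S T GS GT B BG; apply: (csubD (proj1 BG)); [exact: GS|exact: GT].
- by move=> c T GT B BG; apply: (csubZ (proj1 BG)); exact: GT.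
- by move=> S T GS GT B BG; apply: (csubM (proj1 BG)); [exact: GS|exact: GT].
- by move=> S T Tb GS ST B BG; apply: (csub_adjoint (proj1 BG) Tb _ ST); exact: GS.
- move=> T Tb h B BG; apply: (csub_closed (proj1 BG) Tb) => e /h[S GS hS].
  by exists S => //; exact: GS.
Qed.

Lemma sub_generated G : G `<=` cstar_generated G.
Proof. by move=> T GT B [_]; apply. Qed.

(** Adjoints exist for norm limits of operators having adjoints, since the
    adjoints form a Cauchy sequence; this replaces the Riesz representation
    theorem. *)
Lemma norm_limit_adjoint T (Sn Sn' : nat -> H -> H) :
  bounded_operator T -> (forall n, adjoint (Sn n) (Sn' n)) ->
  (forall n x, nm (T x - Sn n x) <= n.+1%:R^-1 * nm x) ->
  exists T', [/\ bounded_operator T', adjoint T T' &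
    forall n x, nm (T' x - Sn' n x) <= n.+1%:R^-1 * nm x].
Proof.
move=> Tb Sadj hS.
have inv_le N n : (N <= n)%N -> n.+1%:R^-1 <= N.+1%:R^-1 :> R.
  by move=> Nn; rewrite lef_pV2 ?posrE// ler_nat.
have S'C n m x : nm (Sn' n x - Sn' m x) <= (n.+1%:R^-1 + m.+1%:R^-1) * nm x.
  have adj : adjoint (fun x => Sn n x - Sn m x) (fun x => Sn' n x - Sn' m x).
    by move=> y z; rewrite dotBl dotBr !Sadj.
  apply: (adjoint_nm _ adj) => [|y]; first by rewrite addr_ge0 ?invr_ge0.
  apply: le_trans (nm_dist (T y) _ _) _; rewrite mulrDl lerD//.
  by rewrite nm_distC.
have /choice[T' hT'] : forall x, exists l, tends (fun n => Sn' n x) l.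
  move=> x; apply: complete_tends => e e0.
  have [|N /(_ N (leqnn _)) hN] := @harmonic_small _ (e / (2 * (nm x + 1))).
    by rewrite divr_gt0// mulr_gt0// ltr_wpDl// nm_ge0.
  exists N => n Nn; apply: le_lt_trans (S'C _ _ _) _.
  apply: le_lt_trans (_ : 2 * N.+1%:R^-1 * nm x < _).
    by rewrite ler_wpM2r ?nm_ge0// mulr_natl mulr2n lerD2r inv_le.
  move: hN; rewrite ltr_pdivlMr; last by rewrite mulr_gt0// ltr_wpDl// nm_ge0.
  apply: le_lt_trans; rewrite mulrCA -mulrA ler_pM2l// ler_wpM2l// lerDl//.
have TT' : adjoint T T'.
  move=> x y; apply: tends_uniq (tends_dotr x (hT' y)).
  have -> : (fun n => dot x (Sn' n y)) = fun n => dot (Sn n x) y.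
    by apply: funext => n; rewrite Sadj.
  apply/tends_dotl/(tends_harmonic (nm_ge0 x)) => n.
  by rewrite nm_distC.
exists T'; split=> // [|n x].
  have [k k0 hk] := bounded_nm Tb.
  apply: nm_bounded (adjoint_nm k0 TT' hk).
  exact: adjoint_linear (adjoint_sym TT').
have adj : adjoint (fun x => T x - Sn n x) (fun x => T' x - Sn' n x).
  by move=> y z; rewrite dotBl dotBr Sadj TT'.
by apply: (adjoint_nm _ adj) => [|y]; rewrite ?invr_ge0.
Qed.

(** The generators need not be closed under adjoints, so the induction carries T
    together with an adjoint T': the T with P T and P T' form a C*-algebra.  A
    trivial P shows that every element has an adjoint in the algebra. *)
Lemma generated_ind G (P : (H -> H) -> Prop) :
  let A := cstar_generated G in
  (forall T, G T -> exists T', [/\ bounded_operator T, bounded_operator T',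
     adjoint T T' & P T /\ P T']) ->
  P (fun=> 0) ->
  (forall S T, A S -> A T -> P S -> P T -> P (fun x => S x + T x)) ->
  (forall (c : R[i]) T, A T -> P T -> P (fun x => c *: T x)) ->
  (forall S T, A S -> A T -> P S -> P T -> P (S \o T)) ->
  (forall T (Sn : nat -> H -> H), A T -> (forall n, A (Sn n) /\ P (Sn n)) ->
     (forall n x, nm (T x - Sn n x) <= n.+1%:R^-1 * nm x) -> P T) ->
  forall T, A T -> exists T', [/\ A T', adjoint T T', P T & P T'].
Proof.
move=> A hG P0 PD PZ PM Plim.
have Ac : cstar_subalgebra A by apply: generated_cstar => T /hG[T' []].
pose D := [set T | A T /\ exists T', [/\ A T', adjoint T T', P T & P T']].
suff /(_ D) : forall B, cstar_subalgebra B /\ G `<=` B -> A `<=` B.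
  move=> h T /h[]//; split; last first.
    move=> S GS; have [S' [Sb S'b SS' [PS PS']]] := hG _ GS.
    have AS : A S by apply: sub_generated.
    by split=> //; exists S'; split=> //; apply: (csub_adjoint Ac S'b AS).
  split.
  - by move=> S [/(csub_bounded Ac)].
  - split; first exact: (csub0 Ac).
    exists (fun=> 0); split=> //; first exact: (csub0 Ac).
    by move=> x y; rewrite dot0l dot0r.
  - move=> S1 S2 [A1 [T1 [A1' a1 P1 P1']]] [A2 [T2 [A2' a2 P2 P2']]].
    split; first exact: (csubD Ac).
    exists (fun x => T1 x + T2 x); split; [exact: (csubD Ac)| |exact: PD|exact: PD].
    by move=> x y; rewrite dotDl dotDr a1 a2.
  - move=> c S1 [A1 [T1 [A1' a1 P1 P1']]].
    split; first exact: (csubZ Ac).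
    exists (fun x => c^*%C *: T1 x).
    split; [exact: (csubZ Ac)| |exact: PZ|exact: PZ].
    by move=> x y; rewrite dotZl dotZr a1 conjcK.
  - move=> S1 S2 [A1 [T1 [A1' a1 P1 P1']]] [A2 [T2 [A2' a2 P2 P2']]].
    split; first exact: (csubM Ac).
    exists (T2 \o T1); split; [exact: (csubM Ac)| |exact: PM|exact: PM].
    by move=> x y /=; rewrite a1 a2.
  - move=> S1 S2 S2b [A1 [T1 [A1' a1 P1 P1']]] a2.
    rewrite (adjoint_uniq a2 a1); split=> //.
    by exists S1; split=> //; apply: adjoint_sym.
  - move=> S Sb happ.
    have AS : A S.
      by apply: (csub_closed Ac Sb) => e /happ[S1 [A1 _] h1]; exists S1.
    split=> //.
    have /choice[Sn hSn] : forall n, exists S1,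
        D S1 /\ forall x, nm (S x - S1 x) <= n.+1%:R^-1 * nm x.
      move=> n; have [|S1 D1 h1] := happ (n.+1%:R^-1)%:C.
        by rewrite ltcR invr_gt0.
      by exists S1; split=> // x; rewrite -lecR rmorphM /= -!nmE.
    have /choice[Sn' hSn'] : forall n, exists S',
        [/\ A S', adjoint (Sn n) S', P (Sn n) & P S'].
      by move=> n; have [[_]] := hSn n.
    have [|n x|S' [S'b SS' hS']] := @norm_limit_adjoint S Sn Sn' Sb.
    + by move=> n; have [] := hSn' n.
    + by have [_] := hSn n.
    have AS' : A S' by apply: csub_adjoint AS SS'.
    exists S'; split=> //.
      apply: (Plim _ Sn) => // n; last by have [_] := hSn n.
      by have [[]] := hSn n; have [] := hSn' n.
    apply: (Plim _ Sn') => // n.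
    by have [] := hSn' n.
by move=> B hB T; apply.
Qed.

End Generated.

Section OpRep.
Variables (R : realType) (H : hilbertType R) (A : set (H -> H)).
Variables (K : hilbertType R) (rho : (H -> H) -> K -> K).
Hypotheses (Ac : cstar_subalgebra A) (A1 : A id).
Hypotheses (rhor : op_representation A rho) (rho1 : forall x, rho id x = x).

(** The inverse of 1 - B exists pointwise; its Neumann partial sums converge in
    norm, so it belongs to A. *)
Lemma neumann_op (B : H -> H) (q : R) : A B -> 0 <= q < 1 ->
  (forall x, nm (B x) <= q * nm x) ->
  exists2 S, A S & forall x, S (x - B x) = x.
Proof.
move=> AB q01 hB; have Bl := proj1 (csub_bounded Ac AB).
have /andP[q0 q1] := q01.
have uniq0 z : z = B z -> z = 0.
  move=> ez; apply/eqP; rewrite -nm_eq0 eq_le nm_ge0 andbT.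
  have := hB z; rewrite -ez -subr_le0 -{1}[nm z]mul1r -mulrBl.
  by rewrite pmulr_rle0// subr_gt0.
have uniqB y x x' : x = y + B x -> x' = y + B x' -> x = x'.
  move=> ex ex'; apply/eqP; rewrite -subr_eq0; apply/eqP/uniq0.
  by rewrite {1}ex {1}ex' opprD addrACA subrr add0r (linB Bl).
have /choice[S hS] : forall y, exists x, x = y + B x.
  by move=> y; apply: neumann q01 _.
have Sl : linear S.
  move=> c x y; apply: (uniqB (c *: x + y)); first exact: hS.
  by rewrite Bl {1}(hS x) {1}(hS y) scalerDr addrACA.
have q1' : 0 < 1 - q by rewrite subr_gt0.
have Sn y : nm (S y) <= (1 - q)^-1 * nm y.
  rewrite mulrC ler_pdivlMr// mulrBr mulr1 lerBlDr.
  by rewrite {1}(hS y) (le_trans (nmD _ _))// lerD2l mulrC.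
exists S; last first.
  by move=> x; apply: (uniqB (x - B x)); [exact: hS|rewrite subrK].
pose P n := iter n (fun T x => x + B (T x)) (fun=> 0).
have AP n : A (P n).
  elim: n => [|n IH]; first exact: (csub0 Ac).
  by apply: (csubD Ac A1); apply: (csubM Ac AB IH).
have SP n y : nm (S y - P n y) <= q ^+ n * ((1 - q)^-1 * nm y).
  elim: n => [|n IH]; first by rewrite subr0 mul1r.
  rewrite {1}(hS y) /= opprD addrACA subrr add0r -(linB Bl) exprS -mulrA.
  by apply: le_trans (hB _) _; rewrite ler_wpM2l.
apply: (csub_closed Ac); first exact: (nm_bounded Sl Sn).
move=> e /real_gt0[d d0 ->].
have [|N hN] := @geometric_small _ (1 - q)^-1 q _ q0 q1 _ d0.
  by rewrite invr_ge0 ltW.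
exists (P N) => // x; rewrite !nmE -rmorphM /= lecR.
by apply: le_trans (SP _ _) _; rewrite mulrA ler_wpM2r ?nm_ge0// ltW.
Qed.

(** As for rep_contractive, the resolvents being found inside A. *)
Lemma oprep_contractive T T' (c : R) : A T -> A T' -> adjoint T T' -> 0 <= c ->
  (forall x, nm (T x) <= c * nm x) -> forall x, nm (rho T x) <= c * nm x.
Proof.
move=> AT AT' TT' c0 hT.
have [k k0 hk] := bounded_nm (oprep_bounded rhor AT).
apply: (nm_le_of_resolvent (oprep_adjoint rhor AT AT' TT') hk k0 c0) => mu hmu.
have mu0 : 0 < mu by apply: le_lt_trans hmu; rewrite sqr_ge0.
have ATT : A (T' \o T) by exact: (csubM Ac AT' AT).
pose B := fun x => (mu^-1)%:C *: (T' \o T) x.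
have AB : A B by exact: (csubZ Ac _ ATT).
have [||S AS hS] := @neumann_op B (c ^+ 2 / mu) AB.
- by rewrite divr_ge0 ?sqr_ge0 ?(ltW mu0)// ltr_pdivrMr// mul1r.
- move=> x; rewrite nmZ nm_real ger0_norm ?invr_ge0 ?(ltW mu0)//.
  rewrite mulrC mulrAC ler_wpM2r ?invr_ge0 ?(ltW mu0)// expr2 -mulrA.
  apply: le_trans (adjoint_nm c0 TT' hT _) _.
  by rewrite ler_wpM2l.
have [q q0 hq] := bounded_nm (oprep_bounded rhor AS).
exists (q * mu^-1) => v.
have {1}<- : rho S ((mu^-1)%:C *: (mu%:C *: v - rho T' (rho T v))) = v.
  rewrite scalerBr scalerA -rmorphM /= mulVf ?gt_eqF// scale1r.
  rewrite -(oprepM rhor AT' AT) -(oprepZ rhor _ ATT) -/B -scaleN1r.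
  rewrite -[v in v + _]rho1 -(oprepZ rhor _ AB).
  have ANB : A (fun x => (-1) *: B x) by exact: (csubZ Ac _ AB).
  rewrite -(oprepD rhor A1 ANB) -(oprepM rhor AS (csubD Ac A1 ANB)).
  rewrite -[RHS]rho1; congr (rho _ v).
  by apply: funext => x; rewrite /= scaleN1r hS.
apply: le_trans (hq _) _.
by rewrite nmZ nm_real ger0_norm ?mulrA// invr_ge0 ltW.
Qed.

Lemma oprep_tends T (Sn : nat -> H -> H) x : A T -> (forall n, A (Sn n)) ->
  (forall T, A T -> exists2 T', A T' & adjoint T T') ->
  (forall n x, nm (T x - Sn n x) <= n.+1%:R^-1 * nm x) ->
  tends (fun n => rho (Sn n) x) (rho T x).
Proof.
move=> AT ASn Aadj h; apply: (tends_harmonic (nm_ge0 x)) => n.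
have AD : A (fun x => T x + (-1) *: Sn n x).
  by apply: (csubD Ac AT); apply: (csubZ Ac).
have [D' AD' DD'] := Aadj _ AD.
have n0 : 0 <= n.+1%:R^-1 :> R by rewrite invr_ge0.
have := oprep_contractive AD AD' DD' n0.
rewrite nm_distC => /(_ _ x); rewrite (oprepD rhor AT (csubZ Ac _ (ASn n))).
by rewrite (oprepZ rhor _ (ASn n)) scaleN1r; apply=> y; rewrite scaleN1r.
Qed.

End OpRep.

(** * Isometries determined by Gram matrices *)

Section Isometry.
Variables (R : realType) (H K : hilbertType R) (W : H -> K).
Hypotheses (Wl : linear W) (Wn : forall x, nm (W x) = nm x).

Lemma isometry_dot x y : dot (W x) (W y) = dot x y.
Proof.
have re u v : complex.Re (dot (W u) (W v)) = complex.Re (dot u v).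
  have := nm_sqD (W u) (W v); rewrite -(linD Wl) !Wn nm_sqD.
  by move=> /addIr/addrI/(mulfI _) h; apply/esym/h; rewrite pnatr_eq0.
have := re x y; have := re ('i%C *: x) y.
rewrite (linZ Wl) !dotZl.
case: (dot (W x) (W y)) => a b; case: (dot x y) => c d /=.
by rewrite !mul0r !mul1r !add0r => /oppr_inj -> ->.
Qed.

Lemma isometry_inj : injective W.
Proof.
move=> x y e; apply/eqP; rewrite -subr_eq0 -nm_eq0 -Wn (linB Wl) e subrr.
by rewrite nm0.
Qed.

Lemma isometry_tends (u : nat -> H) x : tends u x -> tends (W \o u) (W x).
Proof. by apply: (tends_lipschitz (k := 1)) => n; rewrite mul1r -(linB Wl) Wn. Qed.

Lemma isometry_range_closed : closed (range W).
Proof.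
apply: tends_closed => u l /= hu ul.
have /choice[v hv] : forall n, exists x, W x = u n.
  by move=> n; have [x _ <-] := hu n; exists x.
have [|x vx] := @complete_tends _ _ v.
  move=> e e0; have [|N hN] := ul (e / 2); first by rewrite divr_gt0.
  exists N => n Nn; rewrite -Wn (linB Wl) !hv.
  apply: le_lt_trans (nm_dist l _ _) _; rewrite (splitr e) ltrD ?hN//.
  by rewrite nm_distC hN.
exists x => //; apply: tends_uniq ul; have := isometry_tends vx.
by rewrite (_ : W \o v = u)//; apply: funext => n /=.
Qed.

End Isometry.

(** Linear combinations are indexed by lists of weighted indices: the index type
    need not have decidable equality, and sums become concatenations. *)
Definition comb (R : realType) (V : lmodType R[i]) (X : Type) (f : X -> V)
  (s : seq (R[i] * X)) : V := \sum_(p <- s) p.1 *: f p.2.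

Section Comb.
Variables (R : realType) (V : lmodType R[i]) (X : Type) (f : X -> V).

Lemma comb_cat s t : comb f (s ++ t) = comb f s + comb f t.
Proof. by rewrite /comb big_cat. Qed.

Lemma comb_scale c s :
  comb f [seq (c * p.1, p.2) | p <- s] = c *: comb f s.
Proof.
rewrite /comb big_map scaler_sumr; apply: eq_bigr => p _.
by rewrite scalerA.
Qed.

Lemma combB s t :
  comb f s - comb f t = comb f (s ++ [seq (-1 * p.1, p.2) | p <- t]).
Proof. by rewrite comb_cat comb_scale scaleN1r. Qed.

Lemma comb1 x : comb f [:: (1, x)] = f x.
Proof. by rewrite /comb big_seq1 scale1r. Qed.

End Comb.

Section Gram.
Variables (R : realType) (H K : hilbertType R) (X : Type).
Variables (h : X -> H) (k : X -> K).
Hypothesis gram : forall x y, dot (h x) (h y) = dot (k x) (k y).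
Hypothesis hdense : dense (range (comb h)).

Lemma gram_comb s t : nm (comb h s - comb h t) = nm (comb k s - comb k t).
Proof.
have eqd s1 s2 : dot (comb h s1) (comb h s2) = dot (comb k s1) (comb k s2).
  rewrite /comb !dot_suml; apply: eq_bigr => p _.
  rewrite !dot_sumr; apply: eq_bigr => p' _.
  by rewrite !dotZl !dotZr gram.
apply/eqP; rewrite -(@eqrXn2 _ 2) ?nm_ge0// !combB.
by rewrite !nm_sq eqd.
Qed.

(* The graph of the isometry, as the closure of its graph on combinations. *)
Let rel v w := exists s : nat -> seq (R[i] * X),
  tends (fun n => comb h (s n)) v /\ tends (fun n => comb k (s n)) w.

Let rel_total v : exists w, rel v w.
Proof.
have [u hu uv] := dense_seq v hdense.
have /choice[s hs] : forall n, exists s, comb h s = u n.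
  by move=> n; have [s _ <-] := hu n; exists s.
have es : (fun n => comb h (s n)) = u by apply: funext.
have [|w hw] := @complete_tends _ _ (fun n => comb k (s n)).
  move=> e e0; have [|N hN] := uv (e / 2); first by rewrite divr_gt0.
  exists N => n Nn; rewrite -gram_comb !hs.
  apply: le_lt_trans (nm_dist v _ _) _; rewrite (splitr e) ltrD ?hN//.
  by rewrite nm_distC hN.
by exists w, s; rewrite es.
Qed.

Let rel_lin c v w v' w' : rel v w -> rel v' w' ->
  rel (c *: v + v') (c *: w + w').
Proof.
move=> [s [sv sw]] [t [tv tw]].
exists (fun n => [seq (c * p.1, p.2) | p <- s n] ++ t n).
have e (V : lmodType R[i]) (f : X -> V) :
    (fun n => comb f ([seq (c * p.1, p.2) | p <- s n] ++ t n)) =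
    (fun n => c *: comb f (s n) + comb f (t n)).
  by apply: funext => n; rewrite comb_cat comb_scale.
by rewrite !e; split; apply: tendsD => //; apply: tendsZ.
Qed.

Let tends_nm (V : normedModType R[i]) (u : nat -> V) l : tends u l ->
  tends (fun n => (nm (u n))%:C : R[i]) (nm l)%:C.
Proof.
apply: (tends_lipschitz (k := 1)) => n; rewrite mul1r -rmorphB nm_real ler_norml.
have h1 := nmD (u n - l) l; have h2 := nmD (l - u n) (u n).
by rewrite subrK in h1; rewrite subrK nm_distC in h2; apply/andP; split; lra.
Qed.

Let rel_nm v w : rel v w -> nm w = nm v.
Proof.
move=> [s [/tends_nm sv /tends_nm sw]].
apply: (@complexI R); apply: (tends_uniq sw).
rewrite (_ : (fun n => _) = fun n => (nm (comb h (s n)))%:C)//.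
apply: funext => n; congr (_ %:C).
by have := gram_comb (s n) [::]; rewrite /comb !big_nil !subr0.
Qed.

Let rel_fun v w w' : rel v w -> rel v w' -> w = w'.
Proof.
move=> vw vw'; have := rel_lin (-1) vw' vw; rewrite !scaleN1r addNr addrC.
move=> /rel_nm; rewrite nm0 => /eqP; rewrite nm_eq0 subr_eq0.
by move/eqP.
Qed.

(** Norms of combinations depend only on the Gram matrix, so sending one family
    to the other is isometric on combinations; it extends to H by density. *)
Lemma gram_isometry : exists W : H -> K,
  [/\ linear W, forall x, nm (W x) = nm x & forall x, W (h x) = k x].
Proof.
have /choice[W hW] := rel_total; exists W; split.
- by move=> c x y; apply: (rel_fun (hW _)); apply: rel_lin.
- by move=> x; apply: rel_nm.
- move=> x; apply: (rel_fun (hW _)); exists (fun=> [:: (1, x)]).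
  by rewrite !comb1; split; apply: tends_const.
Qed.

End Gram.

(** * Decreasing projections and their fixed vectors *)

Section Projections.
Variables (R : realType) (C : cstarAlgType R).

(** Idempotence is the case n = m of dp_mul. *)
Record decreasing_projections (p : nat -> C) : Prop := {
  dp_star : forall n, star (p n) = p n ;
  dp_mul : forall n m, (n <= m)%N -> p n ** p m = p m }.

Lemma dp_mulr (p : nat -> C) : decreasing_projections p ->
  forall n m, (n <= m)%N -> p m ** p n = p m.
Proof.
move=> dp n m le_nm; rewrite -[LHS]starK starM !(dp_star dp).
by rewrite (dp_mul dp le_nm) (dp_star dp).
Qed.

Definition fixed_space (K : hilbertType R) (sg : C -> K -> K) (p : nat -> C) :=
  [set x | forall n, sg (p n) x = x].

Section RepProj.
Variables (K : hilbertType R) (sg : C -> K -> K).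
Hypothesis sgr : unital_rep sg.
Let sgrep := proj1 sgr.

Lemma rep_nm_sq a x : nm (sg a x) ^+ 2 = complex.Re (dot (sg (star a ** a) x) x).
Proof.
by rewrite nm_sq (repM sgrep) (adjoint_sym (rep_star sgrep a)).
Qed.

Lemma repB a b x : sg (a - b) x = sg a x - sg b x.
Proof. exact: (linB (rep_linl sgr x)). Qed.

Lemma rep_tends_vec (u : nat -> K) a x : tends u x ->
  tends (fun n => sg a (u n)) (sg a x).
Proof. exact: (bounded_tends (rep_bounded sgrep a)). Qed.

Variable p : nat -> C.
Hypothesis dp : decreasing_projections p.

Lemma rep_proj_diff n m x : (n <= m)%N ->
  nm (sg (p n) x - sg (p m) x) ^+ 2 = nm (sg (p n) x) ^+ 2 - nm (sg (p m) x) ^+ 2.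
Proof.
move=> le_nm; rewrite -repB !rep_nm_sq -raddfB /= -dotBl -repB.
rewrite starB !(dp_star dp) cmulBl !cmulBr.
rewrite (dp_mul dp le_nm) (dp_mulr dp le_nm) !(dp_mul dp (leqnn _)).
by rewrite subrr subr0.
Qed.

(** By rep_proj_diff, p_n x is Cauchy because |p_n x|^2 decreases. *)
Lemma rep_proj_cvg x : exists2 y, tends (fun n => sg (p n) x) y &
  fixed_space sg p y.
Proof.
pose D := range (fun n => nm (sg (p n) x) ^+ 2).
have D0 : D !=set0 by exists (nm (sg (p 0%N) x) ^+ 2), 0%N.
have lbD : has_inf D by split=> //; exists 0 => _ [n _ <-]; rewrite sqr_ge0.
have mono n m : (n <= m)%N -> nm (sg (p m) x) ^+ 2 <= nm (sg (p n) x) ^+ 2.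
  by move=> h; rewrite -subr_ge0 -rep_proj_diff// sqr_ge0.
have [|y hy] := @complete_tends _ _ (fun n => sg (p n) x).
  move=> e e0.
  have [_ [N _ <-] hN] : exists2 d, D d & d < inf D + e ^+ 2.
    by apply: inf_adherent => //; rewrite exprn_gt0.
  exists N => n Nn; rewrite nm_distC -(@ltr_pXn2r _ 2) ?nnegrE ?nm_ge0 ?ltW//.
  rewrite rep_proj_diff// ltrBlDl; apply: lt_le_trans hN _.
  by rewrite lerD2r; apply: ge_inf; [exact: (proj2 lbD)|exists n].
exists y => // n; apply: (tends_uniq (rep_tends_vec _ hy)).
apply: (tends_eventually (N := n)) hy => m le_nm.
by rewrite -(repM sgrep) (dp_mul dp le_nm).
Qed.

Lemma fixed_space_dot n x y : fixed_space sg p y ->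
  dot (sg (p n) x) y = dot x y.
Proof. by move=> /(_ n) hy; rewrite (rep_star sgrep) (dp_star dp) hy. Qed.

Lemma fixed_space_of_norm1 x : nm x = 1 ->
  (forall n, dot (sg (p n) x) x = 1) -> fixed_space sg p x.
Proof.
move=> x1 h n; apply/eqP; rewrite -subr_eq0 -nm_eq0 -sqrf_eq0 nm_sqB.
rewrite rep_nm_sq (dp_star dp) (dp_mul dp (leqnn n)) h x1 /=.
by apply/eqP; ring.
Qed.

End RepProj.
End Projections.

(** * GNS representations and automorphisms *)

Section GNS.
Variables (R : realType) (C : cstarAlgType R) (phi : C -> R[i]).
Variables (K : hilbertType R) (pi : C -> K -> K) (xi : K).
Hypotheses (phis : state phi) (gns : GNS_triple phi pi xi).

Lemma gns_unital : unital_rep pi.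
Proof.
have [rep dxi _] := gns; split=> // x.
have [u hu ux] := dense_seq x dxi.
have := bounded_tends (rep_bounded rep cone) ux.
rewrite (_ : (fun n => _) = u) => [/tends_uniq|]; first exact.
by apply: funext => n; have [a _ <-] := hu n; rewrite -(repM rep) cmul1a.
Qed.

Lemma gns_norm : nm xi = 1.
Proof.
have [_ _ h] := gns; have [_ _ _ h1] := phis.
apply/eqP; rewrite -(@eqrXn2 _ 2) ?nm_ge0 ?ler01// expr1n nm_sq.
by have := h cone; rewrite (proj2 gns_unital) h1 => <-.
Qed.

End GNS.

Section Automorphism.
Variables (R : realType) (C : cstarAlgType R) (al : C -> C).
Hypothesis alaut : automorphism al.

Lemma automorphism_unital : al cone = cone.
Proof.
have [_ alM _ [be _ beK]] := alaut.
by rewrite -[LHS]cmula1 -{2}(beK cone) -alM cmul1a beK.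
Qed.

Lemma comp_unital_rep (K : hilbertType R) (sg : C -> K -> K) :
  unital_rep sg -> unital_rep (sg \o al).
Proof.
have [all alM als _] := alaut => sgr; have sgrep := proj1 sgr.
split=> [|x] /=; last by rewrite automorphism_unital (proj2 sgr).
split=> [a|a b x|c a x|a b x|a] /=.
- exact: (rep_bounded sgrep).
- by rewrite (linD all) (repD sgrep).
- by rewrite (linZ all) (repZ sgrep).
- by rewrite alM (repM sgrep).
- by rewrite als; exact: (rep_star sgrep).
Qed.

Lemma automorphism_projections p : decreasing_projections p ->
  decreasing_projections (al \o p).
Proof.
have [_ alM als _] := alaut => dp.
split=> [n|n m nm] /=; first by rewrite -als (dp_star dp).
by rewrite -alM (dp_mul dp).
Qed.

End Automorphism.

(** * Excision in the CAR algebra *)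

Section CAR.
Variables (R : realType) (C : cstarAlgType R).
Variable iota : forall n, 'M[R[i]]_(dimC n) -> C.
Hypothesis car : CAR_algebra iota.

(** Writing q_n as a column times a row makes compression by it visibly scalar,
    without locating its corner in the iterated tensor product. *)
Lemma elem_tens_e00_rank1 n :
  exists (u : 'cV[R[i]]_(dimC n)) (v : 'rV[R[i]]_(dimC n)),
    elem_tens (fun=> e00 R) n = u *m v.
Proof.
elim: n => [|n [u [v IH]]]; first by exists 1%:M, 1%:M; rewrite mulmx1.
exists (tensmx u (delta_mx ord0 ord0 : 'cV_2)).
exists (tensmx v (delta_mx ord0 ord0 : 'rV_2)).
rewrite /= IH; have -> : e00 R = delta_mx ord0 ord0 *m (delta_mx ord0 ord0 : 'rV_2).
  by rewrite mul_delta_mx.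
by rewrite -(tensmx_mul u).
Qed.

Lemma elem_tens_e00_herm n :
  (map_mx Num.conj (elem_tens (fun=> e00 R) n)^T) = elem_tens (fun=> e00 R) n.
Proof.
elim: n => [|n IH] /=; first by rewrite trmx1 map_mx1.
rewrite trmx_tens map_mxT IH; congr (tensmx _ _).
by rewrite trmx_delta map_delta_mx.
Qed.

Lemma elem_tens_e00_idem n :
  elem_tens (fun=> e00 R) n *m elem_tens (fun=> e00 R) n =
  elem_tens (fun=> e00 R) n.
Proof.
elim: n => [|n IH] /=; first by rewrite mulmx1.
by rewrite tensmx_mul IH mul_delta_mx.
Qed.

Lemma q_proj0 : q_proj iota 0 = cone.
Proof. exact: (car1 car). Qed.

Lemma q_proj_decreasing : decreasing_projections (q_proj iota).
Proof.
have star_q n : star (q_proj iota n) = q_proj iota n.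
  by rewrite /q_proj -(car_star car) elem_tens_e00_herm.
have idem n : q_proj iota n ** q_proj iota n = q_proj iota n.
  by rewrite /q_proj -(carM car) elem_tens_e00_idem.
have step n : q_proj iota n ** q_proj iota n.+1 = q_proj iota n.+1.
  rewrite /q_proj -(car_compat car) -(carM car) /=.
  by rewrite tensmx_mul elem_tens_e00_idem mul1mx.
split=> // n m /subnK <-; elim: (m - n)%N => [|k IH]; first exact: idem.
by rewrite addSn -step cmulA IH.
Qed.

Lemma q_proj_compress n (m : 'M[R[i]]_(dimC n)) :
  exists c : R[i], q_proj iota n ** iota m ** q_proj iota n = c *: q_proj iota n.
Proof.
have [u [v e]] := elem_tens_e00_rank1 n.
exists ((v *m m *m u) 0 0).
rewrite /q_proj -!(carM car) -(linZ (car_linear car (n := n))) e; congr (iota _).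
rewrite -!mulmxA [v *m (m *m _)]mulmxA [v *m m *m _]mulmxA.
by rewrite [v *m m *m u]mx11_scalar mul_scalar_mx -scalemxAr !mulmxA.
Qed.

Lemma first_coordinate_q phi n : first_coordinate_state iota phi ->
  phi (q_proj iota n) = 1.
Proof.
by move=> [_ ->]; rewrite big1// => k _; rewrite mxE !eqxx.
Qed.

(** The projections q_n excise phi_r: for b in C_n, q_n b q_n is a multiple of
    q_n, so b acts between vectors fixed by all the q_n as one and the same
    scalar in every representation.  In the GNS representation of phi_r that
    scalar is phi_r b, and density does the rest. *)
Lemma q_proj_excision phi (H0 : hilbertType R) pi0 (xi0 : H0) (K : hilbertType R)
    (sg : C -> K -> K) x y a :
  first_coordinate_state iota phi -> GNS_triple phi pi0 xi0 -> unital_rep sg ->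
  fixed_space sg (q_proj iota) x -> fixed_space sg (q_proj iota) y ->
  dot (sg a x) y = phi a * dot x y.
Proof.
move=> phir gns sgr hx hy.
have phis := proj1 phir; have pir := gns_unital gns.
have [pirep dxi phiE] := gns; have sgrep := proj1 sgr.
have dq := q_proj_decreasing.
have hxi : fixed_space pi0 (q_proj iota) xi0.
  apply: (fixed_space_of_norm1 pir dq (gns_norm phis gns)) => n.
  by rewrite -phiE first_coordinate_q.
have key (K1 : hilbertType R) (tau : C -> K1 -> K1) (z t : K1) n
    (m : 'M[R[i]]_(dimC n)) c : unital_rep tau ->
    fixed_space tau (q_proj iota) z -> fixed_space tau (q_proj iota) t ->
    q_proj iota n ** iota m ** q_proj iota n = c *: q_proj iota n ->
    dot (tau (iota m) z) t = c * dot z t.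
  move=> tr hz ht e; have trep := proj1 tr.
  rewrite -(fixed_space_dot tr dq n _ ht) -{1}(hz n) -!(repM trep) ?cmulA e.
  by rewrite (repZ trep) hz dotZl.
have [u hu ua] := dense_seq a (car_dense car).
have := tends_dotl y (rep_tends sgr x ua).
move/tends_uniq; apply.
have -> : (fun n => dot (sg (u n) x) y) =
    fun n => dot (dot (pi0 (u n) xi0) xi0 *: x) y.
  apply: funext => n; have [k _ [m _ <-]] := hu n.
  have [c hc] := q_proj_compress m.
  rewrite (key _ _ _ _ _ _ _ sgr hx hy hc) (key _ _ _ _ _ _ _ pir hxi hxi hc).
  by rewrite dotZl dot_nm (gns_norm phis gns) expr1n mulr1.
rewrite -dotZl; apply: tends_dotl.
have : tends (fun n => dot (pi0 (u n) xi0) xi0) (phi a).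
  by rewrite phiE; apply: tends_dotl; apply: rep_tends.
by apply: (tends_lipschitz (k := nm x)) => n; rewrite -scalerBl nmZ mulrC.
Qed.

(** The images alpha (q_n) excise phi_r o alpha^-1: apply q_proj_excision to
    the representation sg o alpha. *)
Lemma automorphism_excision phi psi (al : C -> C) (H0 : hilbertType R) pi0
    (xi0 : H0) (K : hilbertType R) (sg : C -> K -> K) x y a :
  first_coordinate_state iota phi -> GNS_triple phi pi0 xi0 ->
  automorphism al -> psi \o al = phi -> unital_rep sg ->
  fixed_space sg (al \o q_proj iota) x -> fixed_space sg (al \o q_proj iota) y ->
  dot (sg a x) y = psi a * dot x y.
Proof.
move=> phir gns alaut psi_al sgr hx hy.
have [_ _ _ [be _ beK]] := alaut.
rewrite -(beK a) -[psi (al _)]/((psi \o al) _) psi_al.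
exact: (q_proj_excision _ phir gns (comp_unital_rep alaut sgr)).
Qed.

End CAR.

(** * Chains of partial isometries *)

Section PartialIsometries.
Variables (R : realType) (C : cstarAlgType R).
Implicit Types p q w : nat -> C.

(** The relations are symmetric under exchanging p with q and w with its
    adjoint (pic_star), so each one-sided fact yields its mirror image. *)
Record partial_isometry_chain p q w : Prop := {
  pic_p : decreasing_projections p ;
  pic_q : decreasing_projections q ;
  pic_p0 : p 0%N = cone ;
  pic_q0 : q 0%N = cone ;
  pic_source : forall n, star (w n) ** w n = p n - p n.+1 ;
  pic_range : forall n, w n ** star (w n) = q n - q n.+1 }.

Lemma pic_star p q w : partial_isometry_chain p q w ->
  partial_isometry_chain q p (star \o w).
Proof. by case=> *; split=> // n /=; rewrite starK. Qed.

Lemma s_elt_star w N : star (s_elt w N) = s_elt (star \o w) N.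
Proof. by rewrite /s_elt star_sum. Qed.

Section Chain.
Variables (p q w : nat -> C).
Hypothesis pw : partial_isometry_chain p q w.
Let dp := pic_p pw.

Lemma source_mulr n N : (n < N)%N -> w n ** p N = 0.
Proof.
move=> nN; apply: cstar_eq0; rewrite starM -cmulA (cmulA _ (w n)) (pic_source pw).
rewrite cmulBl (dp_mul dp nN) (dp_mul dp (ltnW nN)) subrr cmula0.
by [].
Qed.

Lemma source_mull n N : (N <= n)%N -> w n ** p N = w n.
Proof.
move=> Nn; apply/eqP; rewrite -subr_eq0; apply/eqP/cstar_eq0.
rewrite starB starM (dp_star dp) cmulBl !cmulBr -!cmulA.
rewrite !(cmulA _ (w n)) (pic_source pw).
rewrite !(cmulBl, cmulBr) !(dp_mulr dp (_ : (N <= _)%N)) ?(leqW Nn)//.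
by rewrite !(dp_mul dp (_ : (N <= _)%N)) ?(leqW Nn)// !subrr.
Qed.

Lemma s_eltS N : s_elt w N.+1 = s_elt w N + w N.
Proof. by rewrite /s_elt big_ord_recr. Qed.

(** The w_n with n < N live under 1 - p_N, the others under p_N. *)
Lemma s_elt_right N M : (N <= M)%N -> s_elt w M ** (cone - p N) = s_elt w N.
Proof.
move=> /subnK <-; elim: (M - N)%N => [|k IH].
  rewrite add0n cmulBr cmula1 /s_elt cmul_suml [X in _ - X]big1 ?subr0// => i _.
  exact: source_mulr.
rewrite addSn s_eltS cmulDl IH cmulBr cmula1 source_mull ?leq_addl//.
by rewrite subrr addr0.
Qed.

End Chain.

Section Chain2.
Variables (p q w : nat -> C).
Hypothesis pw : partial_isometry_chain p q w.
Let dp := pic_p pw.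
Let qw := pic_star pw.

Lemma s_elt_left N M : (N <= M)%N -> (cone - q N) ** s_elt w M = s_elt w N.
Proof.
move=> NM; rewrite -[LHS]starK starM starB star1 (dp_star (pic_q pw)).
by rewrite s_elt_star (s_elt_right qw NM) -s_elt_star starK.
Qed.

Lemma s_elt_source N : star (s_elt w N) ** s_elt w N = cone - p N.
Proof.
elim: N => [|N IH].
  by rewrite /s_elt big_ord0 cmula0 (pic_p0 pw) subrr.
rewrite s_eltS starD cmulDl !cmulDr IH (pic_source pw).
have cross : star (s_elt w N) ** w N = 0.
  rewrite -(s_elt_left (leqnn N)) starM starB star1 (dp_star (pic_q pw)).
  have h : star (w N) ** q N = star (w N).
    by have := source_mull qw (leqnn N).
  have -> : w N = q N ** w N.
    by rewrite -[RHS]starK starM (dp_star (pic_q pw)) h starK.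
  rewrite -!cmulA (cmulA _ (q N)) cmulBl cmul1a (dp_mul (pic_q pw) (leqnn N)).
  by rewrite subrr cmul0a cmula0.
rewrite cross -[star (w N) ** _]starK starM starK cross star0 addr0 add0r.
by rewrite addrA subrK.
Qed.

End Chain2.
End PartialIsometries.

(** * The operators S + theta *)

Section LOp.
Variables (R : realType) (C : cstarAlgType R) (H : hilbertType R).
Variable Pi : C -> H -> H.
Hypothesis Pir : unital_rep Pi.
Let Pirep := proj1 Pir.

(** On differences of the s_N, the norm is that of the differences of the p_N,
    and p_N x converges. *)
Lemma s_elt_cvg p q w x : partial_isometry_chain p q w ->
  exists y, tends (fun N => Pi (s_elt w N) x) y.
Proof.
move=> pw; have dp := pic_p pw.
have [y hy _] := rep_proj_cvg Pir dp x.
apply: complete_tends => e e0.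
have [|N hN] := hy (e / 2); first by rewrite divr_gt0.
exists N => M NM.
have -> : nm (Pi (s_elt w M) x - Pi (s_elt w N) x) = nm (Pi (p N) x - Pi (p M) x).
  apply/eqP; rewrite -(@eqrXn2 _ 2) ?nm_ge0//; apply/eqP.
  rewrite -(s_elt_right pw NM) cmulBr cmula1 -!(repB Pir) !(rep_nm_sq Pir).
  rewrite opprB addrC subrK starM (dp_star dp) starB !(dp_star dp).
  rewrite -cmulA (cmulA _ (s_elt w M)) (s_elt_source pw).
  rewrite !cmulBl !cmulBr cmul1a !(dp_mul dp (leqnn _)) (dp_mul dp NM).
  by rewrite (dp_mulr dp NM) subrr subr0 (dp_mul dp NM).
apply: le_lt_trans (nm_dist y _ _) _; rewrite (splitr e) ltrD ?hN//.
by rewrite nm_distC hN.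
Qed.

Lemma s_elt_contractive p q w N x : partial_isometry_chain p q w ->
  nm (Pi (s_elt w N) x) <= nm x.
Proof.
move=> pw; have dp := pic_p pw.
rewrite -(@ler_pXn2r _ 2) ?nnegrE ?nm_ge0// (rep_nm_sq Pir) (s_elt_source pw).
rewrite (repB Pir) (proj2 Pir) dotBl raddfB /= -nm_sq lerBlDr lerDl.
have := rep_nm_sq Pir (p N) x; rewrite (dp_star dp) (dp_mul dp (leqnn _)) => <-.
exact: sqr_ge0.
Qed.

Section OneL.
Variables (p q w : nat -> C) (z z' : H).
Hypothesis pw : partial_isometry_chain p q w.
Hypotheses (z1 : nm z = 1) (z1' : nm z' = 1).
Hypothesis pz : forall x, tends (fun n => Pi (p n) x) (dot x z *: z).
Hypothesis zfix : fixed_space Pi p z.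
Let L := L_op Pi w z' z.
Let dp := pic_p pw.

Lemma L_tends x : tends (fun N => Pi (s_elt w N) x + dot x z *: z') (L x).
Proof.
have [y hy] := s_elt_cvg x pw.
rewrite /L /L_op /strong_lim (tends_lim hy) /theta.
by apply: tendsD => //; apply: tends_const.
Qed.

Lemma L_linear : linear L.
Proof.
move=> c x y; apply: (tends_uniq (L_tends _)).
have := tendsD (tendsZ c (L_tends x)) (L_tends y).
rewrite (_ : (fun n => _) =
  fun N => Pi (s_elt w N) (c *: x + y) + dot (c *: x + y) z *: z')//.
apply: funext => N; rewrite (rep_lin Pir) dotDl dotZl scalerDl scalerDr scalerA.
by rewrite addrACA.
Qed.

Lemma L_nm x : nm (L x) <= 2 * nm x.
Proof.
apply: (tends_nm_le (L_tends x)) => N.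
apply: le_trans (nmD _ _) _; rewrite mulr_natl mulr2n lerD//.
  exact: s_elt_contractive pw.
by rewrite nmZ z1' mulr1 (le_trans (cauchy_schwarz _ _))// z1 mulr1.
Qed.

Lemma L_bounded : bounded_operator L.
Proof. exact: nm_bounded L_linear L_nm. Qed.

Lemma L_cut N x : L (Pi (cone - p N) x) = Pi (s_elt w N) x.
Proof.
apply: (tends_uniq (L_tends _)).
apply: (tends_eventually (N := N)) (tends_const _) => M NM.
rewrite -(repM Pirep) (s_elt_right pw NM) (rep_star Pirep) starB star1 (dp_star dp).
by rewrite (repB Pir) (proj2 Pir) zfix subrr dot0r scale0r addr0.
Qed.

Lemma L_unit_vector : L z = z'.
Proof.
apply: (tends_uniq (L_tends _)).
apply: (tends_eventually (N := 0%N)) (tends_const _) => M _.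
rewrite -(s_elt_right pw (leqnn M)) (repM Pirep) (repB Pir) (proj2 Pir) zfix.
by rewrite subrr (lin0 (rep_lin Pir _)) add0r dot_nm z1 expr1n scale1r.
Qed.

(** Every x is the limit of (1 - p_N) x + <x, z> z, by pz.  On such vectors
    L_op is described by L_cut and L_unit_vector without reference to limits,
    which is why identities between representations of it can be checked
    there. *)
Lemma cut_ext (K : hilbertType R) (F G : H -> K) :
  linear F -> linear G ->
  (forall u l, tends u l -> tends (F \o u) (F l)) ->
  (forall u l, tends u l -> tends (G \o u) (G l)) ->
  (forall N x, F (Pi (cone - p N) x) = G (Pi (cone - p N) x)) -> F z = G z ->
  forall x, F x = G x.
Proof.
move=> Fl Gl Fc Gc FG Fz x.
have xl : tends (fun N => Pi (cone - p N) x + dot x z *: z) x.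
  rewrite -[X in tends _ X](subrK (dot x z *: z)).
  apply: tendsD; last exact: tends_const.
  rewrite (_ : (fun N => _) = fun N => x - Pi (p N) x).
    by apply: tendsB => //; exact: tends_const.
  by apply: funext => N; rewrite (repB Pir) (proj2 Pir).
apply: (tends_uniq (Fc _ _ xl)).
rewrite (_ : F \o _ = G \o (fun N => Pi (cone - p N) x + dot x z *: z)).
  exact: Gc.
by apply: funext => N /=; rewrite (linD Fl) (linD Gl) FG (linZ Fl) (linZ Gl) Fz.
Qed.

End OneL.

Section LAdjoint.
Variables (p q w : nat -> C) (z z' : H).
Hypothesis pw : partial_isometry_chain p q w.
Hypotheses (z1 : nm z = 1) (z1' : nm z' = 1).
Hypothesis pz : forall x, tends (fun n => Pi (p n) x) (dot x z *: z).
Hypothesis zfix : fixed_space Pi p z.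
Hypothesis zfix' : fixed_space Pi q z'.
Let L := L_op Pi w z' z.
Let L' := L_op Pi (star \o w) z z'.
Let qw := pic_star pw.

Lemma L_adjoint : adjoint L L'.
Proof.
move=> x y; apply: (tends_uniq (tends_dotl y (L_tends z z' pw x))).
have := tends_dotr x (L_tends z' z qw y).
rewrite (_ : (fun n => _) = fun N => dot (Pi (s_elt w N) x + dot x z *: z') y)//.
apply: funext => N; rewrite dotDl dotDr (rep_star Pirep) s_elt_star; congr (_ + _).
by rewrite dotZl dotZr -dotC mulrC.
Qed.

Lemma L_adjointK x : L' (L x) = x.
Proof.
have Lb : bounded_operator L := L_bounded pw z1 z1'.
have Lb' : bounded_operator L' := L_bounded qw z1' z1.
apply: (cut_ext pz (F := L' \o L) (G := id)) => //.
- by move=> c u v; rewrite [LHS]/= (proj1 Lb) (proj1 Lb').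
- by move=> u l ul; apply: (bounded_tends Lb'); apply: (bounded_tends Lb).
- move=> N u /=.
  have -> : L (Pi (cone - p N) u) = Pi (s_elt w N) u by exact: (L_cut z' pw zfix).
  have {1}-> : Pi (s_elt w N) u = Pi (cone - q N) (Pi (s_elt w N) u).
    by rewrite -(repM Pirep) (s_elt_left pw).
  have -> v : L' (Pi (cone - q N) v) = Pi (s_elt (star \o w) N) v.
    exact: (L_cut z qw zfix').
  by rewrite -s_elt_star -(repM Pirep) (s_elt_source pw).
- have Lz : L z = z' by exact: (L_unit_vector z' pw z1 zfix).
  by rewrite /= Lz; exact: (L_unit_vector z qw z1' zfix').
Qed.

End LAdjoint.
End LOp.

(** * Fixed vectors *)

Section FixedSpace.
Variables (R : realType) (C : cstarAlgType R) (K : hilbertType R).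
Variables (sg : C -> K -> K) (p : nat -> C).
Hypotheses (sgr : unital_rep sg) (dp : decreasing_projections p).

Lemma fixed_spaceD c x y : fixed_space sg p x -> fixed_space sg p y ->
  fixed_space sg p (c *: x + y).
Proof. by move=> hx hy n; rewrite (rep_lin sgr) hx hy. Qed.

Lemma fixed_spaceZ c x : fixed_space sg p x -> fixed_space sg p (c *: x).
Proof. by move=> hx n; rewrite (linZ (rep_lin sgr _)) hx. Qed.

Lemma fixed_space_unit x : fixed_space sg p x -> x != 0 ->
  exists2 y, fixed_space sg p y & nm y = 1.
Proof.
move=> hx x0; have n0 : 0 < nm x by rewrite lt_neqAle eq_sym nm_eq0 x0 nm_ge0.
exists ((nm x)^-1%:C *: x); first exact: fixed_spaceZ.
by rewrite nmZ nm_real ger0_norm ?invr_ge0 ?nm_ge0// mulVf// gt_eqF.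
Qed.

(** The strong limit of the p_n is the orthogonal projection on their common
    fixed space. *)
Lemma proj_cvg_dot x : exists2 y, tends (fun n => sg (p n) x) y &
  fixed_space sg p y /\ forall z, fixed_space sg p z -> dot y z = dot x z.
Proof.
have [y xy fy] := rep_proj_cvg sgr dp x; exists y => //; split=> // z fz.
apply: (tends_uniq (tends_dotl z xy)).
rewrite (_ : (fun n => _) = fun=> dot x z); first exact: tends_const.
by apply: funext => n; exact: (fixed_space_dot sgr dp n x fz).
Qed.

Lemma cut_fixed N x : fixed_space sg p x -> sg (cone - p N) x = 0.
Proof. by move=> hx; rewrite (repB sgr) (proj2 sgr) hx subrr. Qed.

End FixedSpace.

Lemma unitary_inverse (R : realType) (X : Type) (D : set X) (H K : hilbertType R)
    (rho : X -> H -> H) (sigma : X -> K -> K) :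
  unitarily_equivalent D rho sigma -> unitarily_equivalent D sigma rho.
Proof.
move=> [U [Ul Ud Us] UD].
have /choice[V hV] : forall y, exists x, U x = y.
  move=> y; have [x _ <-] : range U y by rewrite Us.
  by exists x.
have Un x : nm (U x) = nm x by apply: nm_eq_dot; rewrite Ud.
have Ui := isometry_inj Ul Un.
exists V; first split.
- by move=> c x y; apply: Ui; rewrite Ul !hV.
- by move=> x y; rewrite -Ud !hV.
- by apply/seteqP; split=> // x _; exists (U x) => //; apply: Ui; rewrite hV.
- by move=> a y Da; apply: Ui; rewrite UD ?hV.
Qed.

(** * Hilbert sums of representations *)

Section Sum.
Variables (R : realType) (I : Type) (Hs : I -> hilbertType R)
  (H : hilbertType R).
Variable inc : forall i, Hs i -> H.
Arguments inc : clear implicits.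
Hypothesis H_sum : hilbert_sum inc.

Lemma inc_nm i x : nm (inc i x) = nm x.
Proof.
by apply: nm_eq_dot; rewrite (hsum_dot H_sum).
Qed.

Lemma inc_tends i (u : nat -> Hs i) x : tends u x ->
  tends (inc i \o u) (inc i x).
Proof.
apply: (@isometry_tends _ _ _ (inc i)); first exact: (hsum_linear H_sum).
exact: inc_nm.
Qed.

Lemma hilbert_sum_ind (P : H -> Prop) :
  (forall x y, P x -> P y -> P (x + y)) ->
  (forall u x, (forall n : nat, P (u n)) -> tends u x -> P x) ->
  P 0 -> (forall i x, P (inc i x)) -> forall x, P x.
Proof.
move=> PD Plim P0 Pinc x.
have [u hu /(Plim _ _)] := dense_seq x (hsum_dense H_sum); apply=> n.
have [m [s [y ->]]] := hu n.
by elim/big_ind : _ => // k _; exact: Pinc.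
Qed.

Variables (C : cstarAlgType R) (pi : forall i, C -> Hs i -> Hs i).
Arguments pi : clear implicits.
Hypothesis pir : forall i, unital_rep (pi i).
Variable Pi : C -> H -> H.
Hypothesis Pi_sum : forall a, operator_sum inc (fun i => pi i a) (Pi a).

Lemma Pi_inc a i x : Pi a (inc i x) = inc i (pi i a x).
Proof. by have [_] := Pi_sum a. Qed.

Lemma hilbert_sum_ext (S T : H -> H) :
  bounded_operator S -> bounded_operator T ->
  (forall i x, S (inc i x) = T (inc i x)) -> forall x, S x = T x.
Proof.
move=> Sb Tb ST; apply: hilbert_sum_ind => //.
- by move=> x y Sx Sy; rewrite (linD (proj1 Sb)) (linD (proj1 Tb)) Sx Sy.
- move=> u x hu ux; apply: (tends_uniq (bounded_tends Sb ux)).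
  by rewrite (funext hu); exact: bounded_tends.
- by rewrite (lin0 (proj1 Sb)) (lin0 (proj1 Tb)).
Qed.

Lemma sum_unital_rep : unital_rep Pi.
Proof.
have Pib a : bounded_operator (Pi a) by have [] := Pi_sum a.
have bc := @bounded_cstar R H.
have incl i : linear (inc i) by exact: (hsum_linear H_sum).
split; first split=> //.
- move=> a b; apply: hilbert_sum_ext => //; first exact: (csubD bc (Pib a) (Pib b)).
  by move=> i x; rewrite !Pi_inc (repD (proj1 (pir i))) (linD (incl i)).
- move=> c a; apply: hilbert_sum_ext => //; first exact: (csubZ bc c (Pib a)).
  by move=> i x; rewrite !Pi_inc (repZ (proj1 (pir i))) (linZ (incl i)).
- move=> a b; apply: hilbert_sum_ext => //; first exact: (csubM bc (Pib a) (Pib b)).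
  by move=> i x; rewrite !Pi_inc (repM (proj1 (pir i))).
- move=> a x y; elim/hilbert_sum_ind : x.
  + move=> x x' hx hx'; rewrite (linD (proj1 (Pib a))) !dotDl.
    by rewrite hx hx'.
  + move=> u x hu ux; apply: (tends_uniq (tends_dotl _ (bounded_tends (Pib a) ux))).
    by rewrite (funext hu); apply: tends_dotl.
  + by rewrite (lin0 (proj1 (Pib a))) !dot0l.
  + move=> i x; elim/hilbert_sum_ind : y.
    * move=> y y' hy hy'; rewrite (linD (proj1 (Pib _))) !dotDr.
      by rewrite hy hy'.
    * move=> u y hu uy; apply: (tends_uniq (tends_dotr _ uy)).
      by rewrite (funext hu); apply/tends_dotr/bounded_tends.
    * by rewrite (lin0 (proj1 (Pib _))) !dot0r.
    * move=> j y; rewrite !Pi_inc.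
      have [ij|ij] := pselect (i = j); last by rewrite !(hsum_orth H_sum).
      by subst j; rewrite !(hsum_dot H_sum) (rep_star (proj1 (pir i))).
- apply: hilbert_sum_ext => [//||i x]; last by rewrite Pi_inc (proj2 (pir i)).
  by apply: (@nm_bounded _ _ _ 1) => // x; rewrite mul1r.
Qed.

End Sum.

(** * Families of excised pure states *)

Section ExcisingFamily.
Variables (R : realType) (C : cstarAlgType R) (I : Type).
Variables (phi : I -> C -> R[i]) (p : I -> nat -> C).
Hypothesis p_proj : forall i, decreasing_projections (p i).

(** For a unit vector x = y this says that the vectors fixed by p_i carry the
    state phi_i; with two vectors it also computes the fixed space itself. *)
Definition excising (K : hilbertType R) (sg : C -> K -> K) :=
  forall i x y a, fixed_space sg (p i) x -> fixed_space sg (p i) y ->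
    dot (sg a x) y = phi i a * dot x y.

Hypothesis excision : forall (K : hilbertType R) (sg : C -> K -> K),
  unital_rep sg -> excising sg.

Variables (Hs : I -> hilbertType R) (pi : forall i, C -> Hs i -> Hs i).
Variable xi : forall i, Hs i.
Arguments pi : clear implicits.
Hypothesis phi_state : forall i, state (phi i).
Hypothesis gns : forall i, GNS_triple (phi i) (pi i) (xi i).
Hypothesis xi_fixed : forall i, fixed_space (pi i) (p i) (xi i).

Let pir i : unital_rep (pi i). Proof. exact: gns_unital (gns i). Qed.
Let xi1 i : nm (xi i) = 1.
Proof. exact: (gns_norm (phi_state i) (gns i)). Qed.

(** By excision, a fixed vector orthogonal to the cyclic vector xi_i is
    orthogonal to all of C xi_i. *)
Lemma fixed_line i y : fixed_space (pi i) (p i) y ->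
  y = dot y (xi i) *: xi i.
Proof.
move=> fy; apply/eqP; rewrite -subr_eq0; apply/eqP.
have [_ dxi _] := gns i.
apply: (dense_dot0 dxi) => _ [a _ <-].
rewrite -scaleNr addrC (excision (pir i) a (xi_fixed i)); last exact: fixed_spaceD.
by rewrite dotDr dotZr rmorphN /= -dotC dot_nm xi1 expr1n mulr1 addNr mulr0.
Qed.

(** A nonzero invariant subspace V contains a vector v with <v, xi_i> != 0; the
    limit of p_n v is then a nonzero multiple of xi_i lying in V, and xi_i is
    cyclic. *)
Lemma gns_irreducible i : irreducible_rep setT (pi i).
Proof.
move=> V Vc V0 Vlin Vinv; have [_ dxi _] := gns i.
have [[v Vv v0]|hV] := pselect (exists2 v, V v & v != 0); last first.
  left; apply/seteqP; split=> [v Vv|v -> //] /=; apply: contrapT => /eqP v0.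
  by apply: hV; exists v.
right; apply/seteqP; split=> // z _.
have [a ha] : exists a, dot (pi i a (xi i)) v != 0.
  apply: contrapT => h; move/eqP: v0; apply; apply: (dense_dot0 dxi) => _ [a _ <-].
  by apply/eqP; apply: contrapT => ha; apply: h; exists a; apply/negP.
have [y hy [fy dy]] := proj_cvg_dot (pir i) (p_proj i) (pi i (star a) v).
have Vy : V y.
  by apply: (closed_tends Vc _ hy) => n; do 2!apply: (Vinv _ _ Logic.I).
have yxi : dot y (xi i) != 0.
  rewrite (dy _ (xi_fixed i)) dotC -(rep_star (proj1 (pir i))) -dotC.
  by apply: contra ha => /eqP h; rewrite dotC h conjc0.
have Vxi : V (xi i).
  rewrite -[xi i](scalerK yxi) -fixed_line// -[_ *: y]addr0.
  exact: Vlin.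
have [u hu uz] := dense_seq z dxi.
by apply: (closed_tends Vc _ uz) => n; have [b _ <-] := hu n; apply: Vinv.
Qed.

(** The vector y gives the state phi_j, so pi_j a xi_j and sg a y have the same
    Gram matrix. *)
Lemma fixed_intertwiner j (K : hilbertType R) (sg : C -> K -> K) y :
  unital_rep sg -> fixed_space sg (p j) y -> nm y = 1 ->
  exists W : Hs j -> K, [/\ linear W, forall x, nm (W x) = nm x,
    W (xi j) = y & forall a x, W (pi j a x) = sg a (W x)].
Proof.
move=> sgr fy y1; have [_ dxi _] := gns j.
have grm (K1 : hilbertType R) (tau : C -> K1 -> K1) z a b : unital_rep tau ->
    fixed_space tau (p j) z -> nm z = 1 ->
    dot (tau a z) (tau b z) = phi j (star b ** a).
  move=> tr fz z1; rewrite -[b in LHS]starK -(rep_star (proj1 tr)).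
  rewrite -(repM (proj1 tr)).
  by rewrite (excision tr _ fz fz) dot_nm z1 expr1n mulr1.
have [a b||W [Wl Wn Wh]] := @gram_isometry R (Hs j) K C
    (fun a => pi j a (xi j)) (fun a => sg a y).
- by rewrite (grm _ _ _ _ _ (pir j) (xi_fixed j)) ?(grm _ _ _ _ _ sgr fy).
- apply: dense_sub dxi => _ [a _ <-]; exists [:: (1, a)] => //.
  by rewrite comb1.
exists W; split=> //.
  by rewrite -(proj2 (pir j) (xi j)) Wh (proj2 sgr).
move=> a x; have [u hu ux] := dense_seq x dxi.
apply: (tends_uniq (isometry_tends Wl Wn (rep_tends_vec (pir j) a ux))).
have := rep_tends_vec sgr a (isometry_tends Wl Wn ux).
rewrite (_ : (fun n => _) = W \o (fun n => pi j a (u n)))//.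
apply: funext => n /=; have [b _ <-] := hu n.
by rewrite Wh -(repM (proj1 sgr)) -(repM (proj1 (pir j))) Wh.
Qed.

Hypothesis pi_classes : forall (K : hilbertType R) (sigma : C -> K -> K),
  representation sigma -> nonzero_rep setT sigma ->
  irreducible_rep setT sigma ->
  exists! i, unitarily_equivalent setT sigma (pi i).

(** Otherwise pi_j would embed in the irreducible pi_i, hence be equivalent to
    it, against the uniqueness of the index of a class. *)
Lemma fixed_other i j y : i <> j -> fixed_space (pi i) (p j) y -> y = 0.
Proof.
move=> ij fy; apply: contrapT => /eqP y0; apply: ij.
have [z fz z1] := fixed_space_unit (pir i) fy y0.
have [W [Wl Wn Wxi Wpi]] := fixed_intertwiner (pir i) fz z1.
have Ws : range W = setT.
  have [||||h|//] := @gns_irreducible i (range W).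
  - exact: isometry_range_closed.
  - by exists 0 => //; rewrite (lin0 Wl).
  - by move=> c _ _ [x _ <-] [x' _ <-]; exists (c *: x + x') => //; rewrite Wl.
  - by move=> a _ _ [x _ <-]; exists (pi j a x) => //; rewrite Wpi.
  have : [set 0] z by rewrite -h; exists (xi j).
  by move=> /= z0; move: z1; rewrite z0 nm0 => /esym/eqP; rewrite oner_eq0.
have [||k [_ uniqk]] := @pi_classes _ (pi j) (proj1 (pir j)).
- exists cone, (xi j); split=> //; rewrite (proj2 (pir j)).
  by rewrite -nm_eq0 xi1 oner_eq0.
- exact: gns_irreducible.
rewrite -(uniqk i); last by exists W => //; split=> //; exact: isometry_dot.
apply: uniqk; exists id => //; split=> //.
by apply/seteqP; split=> // x _; exists x.
Qed.

(** As |p_(j,n) a x|^2 = phi_i (a* p_(j,n) a), it can be computed in pi_i,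
    where p_(j,n) tends strongly to 0 by fixed_other. *)
Lemma fixed_orthogonal (K : hilbertType R) (sg : C -> K -> K) i j x y a :
  unital_rep sg -> i <> j -> fixed_space sg (p i) x -> nm x = 1 ->
  fixed_space sg (p j) y -> dot (sg a x) y = 0.
Proof.
move=> sgr ij fx x1 fy.
have [W [Wl Wn Wxi Wpi]] := fixed_intertwiner sgr fx x1.
have [z hz fz] := rep_proj_cvg (pir i) (p_proj j) (pi i a (xi i)).
have := tends_dotl y (isometry_tends Wl Wn hz).
rewrite (fixed_other ij fz) (lin0 Wl) dot0l => h; apply/esym/(tends_uniq h).
rewrite (_ : (fun n => _) = fun=> dot (sg a x) y); first exact: tends_const.
apply: funext => n /=; rewrite !Wpi Wxi.
exact: (fixed_space_dot sgr (p_proj j) n _ fy).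
Qed.

(** Both sides are phi_i (b* a) when i = j, by excision, and 0 otherwise. *)
Lemma fixed_gram (K K' : hilbertType R) (sg : C -> K -> K) (sg' : C -> K' -> K')
    (x : I -> K) (x' : I -> K') i j a b :
  unital_rep sg -> unital_rep sg' ->
  (forall i, fixed_space sg (p i) (x i) /\ nm (x i) = 1) ->
  (forall i, fixed_space sg' (p i) (x' i) /\ nm (x' i) = 1) ->
  dot (sg a (x i)) (sg b (x j)) = dot (sg' a (x' i)) (sg' b (x' j)).
Proof.
move=> sgr sgr' hx hx'.
have [f n] := hx i; have [f' n'] := hx' i.
have [fj _] := hx j; have [fj' _] := hx' j.
rewrite -[b]starK -!(rep_star (proj1 sgr)) -!(rep_star (proj1 sgr')).
rewrite -(repM (proj1 sgr)) -(repM (proj1 sgr')).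
have [ij|ij] := pselect (i = j).
  by subst j; rewrite (excision sgr _ f fj) (excision sgr' _ f' fj') !dot_nm n n'.
by rewrite (fixed_orthogonal _ sgr ij)// (fixed_orthogonal _ sgr' ij).
Qed.

Section HilbertSum.
Variables (H : hilbertType R) (inc : forall i, Hs i -> H).
Arguments inc : clear implicits.
Hypothesis H_sum : hilbert_sum inc.
Variable Pi : C -> H -> H.
Hypothesis Pi_sum : forall a, operator_sum inc (fun i => pi i a) (Pi a).

Let zeta i := inc i (xi i).
Let Pir : unital_rep Pi := sum_unital_rep H_sum pir Pi_sum.

Lemma zeta_nm i : nm (zeta i) = 1.
Proof. by rewrite /zeta (inc_nm H_sum). Qed.

Lemma zeta_fixed i : fixed_space Pi (p i) (zeta i).
Proof. by move=> n; rewrite /zeta (Pi_inc Pi_sum) xi_fixed. Qed.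

(** The vectors Pi a zeta_i are total, in a form suited to proving equalities
    of continuous maps. *)
Lemma zeta_ind (P : H -> Prop) :
  (forall x y, P x -> P y -> P (x + y)) ->
  (forall u x, (forall n : nat, P (u n)) -> tends u x -> P x) ->
  (forall i a, P (Pi a (zeta i))) -> P 0 -> forall x, P x.
Proof.
move=> PD Plim Pz P0; apply: (hilbert_sum_ind H_sum) => // i x.
have [_ dxi _] := gns i; have [u hu ux] := dense_seq x dxi.
apply: (Plim _ _ _ (inc_tends H_sum ux)) => n /=.
by have [a _ <-] := hu n; rewrite -(Pi_inc Pi_sum); exact: Pz.
Qed.

Lemma zeta_cyclic :
  dense (range (comb (fun ia : I * C => Pi ia.2 (zeta ia.1)))).
Proof.
apply: dense_of_approx; apply: zeta_ind => [x y hx hy|u x hu ux|i a|] e e0.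
- have e2 : 0 < e / 2 by rewrite divr_gt0.
  have [_ [s _ <-] hs] := hx _ e2; have [_ [t _ <-] ht] := hy _ e2.
  exists (comb (fun ia : I * C => Pi ia.2 (zeta ia.1)) (s ++ t)).
    by exists (s ++ t).
  rewrite comb_cat opprD addrACA (le_lt_trans (nmD _ _))//.
  by rewrite (splitr e) ltrD.
- have e2 : 0 < e / 2 by rewrite divr_gt0.
  have [N hN] := ux _ e2; have [s Ss hs] := hu N _ e2; exists s => //.
  apply: le_lt_trans (nm_dist (u N) _ _) _.
  by rewrite (splitr e) ltrD// nm_distC hN.
- exists (Pi a (zeta i)); last by rewrite subrr nm0.
  by exists [:: (1, (i, a))] => //; rewrite comb1.
- exists 0; last by rewrite subrr nm0.
  by exists [::] => //; rewrite /comb big_nil.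
Qed.

(** The common fixed space of the Pi (p_(i,n)) is the line of zeta_i: by excision
    within the i-th summand, by fixed_orthogonal against the others. *)
Lemma Pi_fixed_line i x :
  tends (fun n => Pi (p i n) x) (dot x (zeta i) *: zeta i).
Proof.
have [y xy [fy dy]] := proj_cvg_dot Pir (p_proj i) x.
have fz := @zeta_fixed i; have z1 := zeta_nm i.
rewrite -(dy _ fz); suff {1}<- : y = dot y (zeta i) *: zeta i by [].
apply/eqP; rewrite -subr_eq0; apply/eqP; set y' := _ - _.
have fy' : fixed_space Pi (p i) y'.
  by rewrite /y' -scaleNr addrC; apply: fixed_spaceD.
have zy' : dot (zeta i) y' = 0.
  by rewrite /y' dotBr dotZr -dotC dot_nm z1 expr1n mulr1 subrr.
apply: dot_eq0 => x'; rewrite dotC; apply/eqP; rewrite conjc_eq0; apply/eqP.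
move: x'; apply: zeta_ind => [u v hu hv|u l hu ul|j a|].
- by rewrite dotDl hu hv addr0.
- apply: (tends_uniq (tends_dotl _ ul)).
  by rewrite (funext hu); exact: tends_const.
- have [ji|ji] := pselect (j = i).
    by subst j; rewrite (excision Pir _ fz fy') zy' mulr0.
  exact: (fixed_orthogonal _ Pir ji (@zeta_fixed j) (zeta_nm j)).
- exact: dot0l.
Qed.

End HilbertSum.
End ExcisingFamily.

(** * Irreducible representations of A *)

Section InclusionUnique.
Variables (R : realType) (C : cstarAlgType R) (I : Type) (r : I).
Variables (phi : I -> C -> R[i]) (p : I -> nat -> C) (w : I -> nat -> C).
Hypothesis p_proj : forall i, decreasing_projections (p i).
Hypothesis excision : forall (K : hilbertType R) (sg : C -> K -> K),
  unital_rep sg -> excising phi p sg.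
Hypothesis chain : forall i, partial_isometry_chain (p i) (p r) (w i).
Hypothesis w_r : forall n, w r n = p r n - p r n.+1.
Variables (Hs : I -> hilbertType R) (pi : forall i, C -> Hs i -> Hs i).
Variable xi : forall i, Hs i.
Arguments pi : clear implicits.
Hypothesis phi_state : forall i, state (phi i).
Hypothesis gns : forall i, GNS_triple (phi i) (pi i) (xi i).
Hypothesis xi_fixed : forall i, fixed_space (pi i) (p i) (xi i).
Hypothesis pi_classes : forall (K : hilbertType R) (sigma : C -> K -> K),
  representation sigma -> nonzero_rep setT sigma ->
  irreducible_rep setT sigma ->
  exists! i, unitarily_equivalent setT sigma (pi i).
Variables (H : hilbertType R) (inc : forall i, Hs i -> H).
Arguments inc : clear implicits.
Hypothesis H_sum : hilbert_sum inc.
Variable Pi : C -> H -> H.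
Hypothesis Pi_sum : forall a, operator_sum inc (fun i => pi i a) (Pi a).

Let zeta i := inc i (xi i).
Let L i := L_op Pi (w i) (zeta r) (zeta i).
Let L' i := L_op Pi (star \o w i) (zeta i) (zeta r).
Let A := cstar_generated (range Pi `|` range L).

Let pir i : unital_rep (pi i). Proof. exact: gns_unital (gns i). Qed.
Let Pir : unital_rep Pi := sum_unital_rep H_sum pir Pi_sum.
Let Pirep := proj1 Pir.
Let z1 i : nm (zeta i) = 1.
Proof. exact: (zeta_nm phi_state gns H_sum). Qed.
Let zf i : fixed_space Pi (p i) (zeta i).
Proof. exact: (zeta_fixed xi_fixed Pi_sum). Qed.
Let pz i x : tends (fun n => Pi (p i n) x) (dot x (zeta i) *: zeta i).
Proof.
exact: (Pi_fixed_line p_proj excision phi_state gns xi_fixed pi_classes H_sum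
  Pi_sum).
Qed.

Let Lb i : bounded_operator (L i).
Proof. exact: (L_bounded Pir (chain i)). Qed.
Let L'b i : bounded_operator (L' i).
Proof. exact: (L_bounded Pir (pic_star (chain i))). Qed.
Let LL' i : adjoint (L i) (L' i).
Proof. exact: (L_adjoint Pir _ _ (chain i)). Qed.
Let L'K i x : L' i (L i x) = x.
Proof. exact: (L_adjointK Pir (chain i)). Qed.
Let LK i x : L i (L' i x) = x.
Proof.
have := @L_adjointK _ _ _ Pi Pir _ _ _ (zeta r) (zeta i) (pic_star (chain i)).
rewrite (_ : star \o _ = w i); last by apply: funext => n /=; rewrite starK.
exact.
Qed.
Let L_cut_i i N x : L i (Pi (cone - p i N) x) = Pi (s_elt (w i) N) x.
Proof. exact: (L_cut Pir _ (chain i)). Qed.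
Let L'_cut_i i N x : L' i (Pi (cone - p r N) x) = Pi (star (s_elt (w i) N)) x.
Proof. by rewrite s_elt_star; exact: (L_cut Pir _ (pic_star (chain i))). Qed.
Let L_zeta i : L i (zeta i) = zeta r.
Proof. exact: (L_unit_vector Pir _ (chain i)). Qed.

(* L r is the identity because w_r = f_n, so that s_(r,N) = 1 - q_N. *)
Let LrE x : L r x = x.
Proof.
apply: (cut_ext Pir (@pz r) (F := L r) (G := id)) => //.
- exact: (proj1 (Lb r)).
- by move=> u l; exact: bounded_tends.
- move=> N y; rewrite L_cut_i; congr (Pi _ y).
  elim: N => [|N IH]; first by rewrite /s_elt big_ord0 (pic_p0 (chain r)) subrr.
  by rewrite s_eltS IH w_r addrA subrK.
Qed.

Let G_bounded T : (range Pi `|` range L) T -> exists T',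
  [/\ bounded_operator T, bounded_operator T', adjoint T T' &
    True /\ True].
Proof.
move=> [[a _ <-]|[i _ <-]].
  exists (Pi (star a)); split=> //; try exact: (rep_bounded Pirep).
  exact: (rep_star Pirep).
by exists (L' i); split.
Qed.

Let Ac : cstar_subalgebra A.
Proof. by apply: generated_cstar => T /G_bounded[T' []]. Qed.

Let A_Pi a : A (Pi a).
Proof. by apply: sub_generated; left; exists a. Qed.
Let A_L i : A (L i).
Proof. by apply: sub_generated; right; exists i. Qed.
Let A_L' i : A (L' i).
Proof. exact: (csub_adjoint Ac (L'b i) (A_L i)). Qed.
Let A1 : A id.
Proof.
by rewrite (_ : id = Pi cone)//; apply: funext => x; rewrite (proj2 Pir).
Qed.

Let A_adj T : A T -> exists2 T', A T' & adjoint T T'.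
Proof.
move=> AT.
have [||||||T' [AT' TT' _ _]] := @generated_ind _ _ (range Pi `|` range L)
  (fun=> True) _ _ _ _ _ _ T AT => //; last by exists T'.
Qed.

Variables (K : hilbertType R) (rho : (H -> H) -> (K -> K)).
Hypotheses (rhor : op_representation A rho) (rho_nz : nonzero_rep A rho).
Hypothesis rho_irr : irreducible_rep A rho.

Let rho_lin T : A T -> linear (rho T).
Proof. by move=> AT; have [] := oprep_bounded rhor AT. Qed.

(* The range of the idempotent rho id is invariant and nonzero. *)
Let rho1 x : rho id x = x.
Proof.
pose V := [set y : K | rho id y = y].
have idem T y : A T -> rho id (rho T y) = rho T y.
  by move=> AT; rewrite -(oprepM rhor A1 AT).
have [||||V0|VT] := @rho_irr V.
- apply: tends_closed => u l hu ul.
  apply: (tends_uniq (bounded_tends (oprep_bounded rhor A1) ul)).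
  by rewrite (funext hu).
- exact: (lin0 (rho_lin A1)).
- by move=> c y z hy hz; rewrite /V /= (rho_lin A1) hy hz.
- by move=> T y AT _; exact: idem.
- have [T [y [AT]]] := rho_nz; suff -> : rho T y = 0 by rewrite eqxx.
  by have : V (rho T y) by [exact: idem]; rewrite V0.
- by have : V x by rewrite VT.
Qed.

Let sg a := rho (Pi a).

Let sgr : unital_rep sg.
Proof.
split=> [|x]; last first.
  rewrite /sg (_ : Pi cone = id) ?rho1//; apply: funext => y.
  exact: (proj2 Pir).
split=> [a|a b x|c a x|a b x|a].
- exact: (oprep_bounded rhor (A_Pi a)).
- rewrite /sg -(oprepD rhor (A_Pi a) (A_Pi b)); congr (rho _ x).
  by apply: funext => y; rewrite (repD Pirep).
- rewrite /sg -(oprepZ rhor _ (A_Pi a)); congr (rho _ x).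
  by apply: funext => y; rewrite (repZ Pirep).
- rewrite /sg -(oprepM rhor (A_Pi a) (A_Pi b)); congr (rho _ x).
  by apply: funext => y; rewrite (repM Pirep).
- exact: (oprep_adjoint rhor (A_Pi a) (A_Pi _) (rep_star Pirep a)).
Qed.
Let sgrep := proj1 sgr.

Let U i := rho (L i).
Let U' i := rho (L' i).

Let UU' i : adjoint (U i) (U' i).
Proof. exact: (oprep_adjoint rhor (A_L i) (A_L' i)). Qed.
Let U'K i x : U' i (U i x) = x.
Proof.
rewrite /U /U' -(oprepM rhor (A_L' i) (A_L i)) -[RHS]rho1; congr (rho _ x).
by apply: funext => y; exact: L'K.
Qed.
Let UK i x : U i (U' i x) = x.
Proof.
rewrite /U /U' -(oprepM rhor (A_L i) (A_L' i)) -[RHS]rho1; congr (rho _ x).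
by apply: funext => y; exact: LK.
Qed.
Let U_cut i N x : U i (sg (cone - p i N) x) = sg (s_elt (w i) N) x.
Proof.
rewrite /U /sg -(oprepM rhor (A_L i) (A_Pi _)); congr (rho _ x).
by apply: funext => y; exact: L_cut_i.
Qed.
Let U'_cut i N x : U' i (sg (cone - p r N) x) = sg (star (s_elt (w i) N)) x.
Proof.
rewrite /U' /sg -(oprepM rhor (A_L' i) (A_Pi _)); congr (rho _ x).
by apply: funext => y; exact: L'_cut_i.
Qed.
Let Ub i : bounded_operator (U i).
Proof. exact: (oprep_bounded rhor (A_L i)). Qed.
Let UrE x : U r x = x.
Proof. by rewrite /U (_ : L r = id) ?rho1//; apply: funext. Qed.

Let rho0 x : rho (fun=> 0) x = 0.
Proof.
rewrite (_ : (fun=> 0) = fun y : H => 0 *: id y).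
  by rewrite (oprepZ rhor _ A1) scale0r.
by apply: funext => y; rewrite scale0r.
Qed.

Let rho_tends T (Sn : nat -> H -> H) x : A T -> (forall n, A (Sn n)) ->
  (forall n x, nm (T x - Sn n x) <= n.+1%:R^-1 * nm x) ->
  tends (fun n => rho (Sn n) x) (rho T x).
Proof.
move=> AT ASn h; exact: (oprep_tends Ac A1 rhor rho1).
Qed.

(* Without fixed vectors sg (1 - p_(i,N)) tends strongly to 1, so U i is the
   strong limit of sg (s_(i,N)), and likewise for its adjoint: every subspace
   invariant under C is invariant under A. *)
Let no_fixed_irreducible : (forall i x, fixed_space sg (p i) x -> x = 0) ->
  irreducible_rep setT sg.
Proof.
move=> nofix V Vc V0 Vlin Vinv.
have push T i a x : A T ->
    (forall N y, rho T (sg (cone - p i N) y) = sg (a N) y) ->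
    V x -> V (rho T x).
  move=> AT Ta Vx; have [y py fy] := rep_proj_cvg sgr (p_proj i) x.
  rewrite (nofix _ _ fy) in py.
  have xl : tends (fun N => sg (cone - p i N) x) x.
    rewrite -[X in tends _ X]subr0 (_ : (fun N => _) = fun N => x - sg (p i N) x).
      by apply: tendsB => //; exact: tends_const.
    by apply: funext => N; rewrite (repB sgr) (proj2 sgr).
  apply: (closed_tends Vc _ (bounded_tends (oprep_bounded rhor AT) xl)) => N.
  by rewrite Ta; apply: Vinv.
apply: rho_irr => // T x AT Vx.
have VD y z : V y -> V z -> V (y + z).
  by move=> Vy Vz; rewrite -[y]scale1r; exact: Vlin.
have VZ c y : V y -> V (c *: y).
  by move=> Vy; rewrite -[_ *: y]addr0; exact: Vlin.
have [||||||T' [_ _ h _]] := @generated_ind _ _ (range Pi `|` range L)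
  (fun T => forall x, V x -> V (rho T x)) _ _ _ _ _ _ T AT; last exact: h.
- move=> _ [[a _ <-]|[i _ <-]].
    exists (Pi (star a)); split; try exact: (rep_bounded Pirep).
      exact: (rep_star Pirep).
    by split=> y Vy; apply: Vinv.
  exists (L' i); split=> //; split=> y.
    by apply: (push _ i); [exact: A_L|exact: U_cut].
  by apply: (push _ r); [exact: A_L'|exact: U'_cut].
- by move=> y _; rewrite rho0.
- by move=> S1 S2 AS1 AS2 h1 h2 y Vy; rewrite (oprepD rhor AS1 AS2); auto.
- by move=> c S1 AS1 h1 y Vy; rewrite (oprepZ rhor _ AS1); auto.
- by move=> S1 S2 AS1 AS2 h1 h2 y Vy; rewrite (oprepM rhor AS1 AS2); auto.
- move=> S1 Sn AS1 hSn hlim y Vy.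
  apply: (closed_tends Vc _ (rho_tends y AS1 _ hlim)) => n.
    by have [_] := hSn n; apply.
  by have [] := hSn n.
Qed.

(* Otherwise sg is irreducible, hence equivalent to some pi_i, where xi_i is
   fixed. *)
Let exists_fixed : exists i, exists2 x, fixed_space sg (p i) x & x != 0.
Proof.
apply: contrapT => nofix.
have nofix' i x : fixed_space sg (p i) x -> x = 0.
  move=> fx; apply: contrapT => /eqP x0; apply: nofix; exists i.
  by exists x.
have [||i [[V [Vl Vd Vs] VD] _]] := @pi_classes _ sg sgrep.
- have [T [y [AT Ty]]] := rho_nz; exists cone, (rho T y); split=> //.
  by rewrite (proj2 sgr).
- exact: no_fixed_irreducible.
have [x _ Vx] : range V (xi i) by rewrite Vs.
have Vn y : nm (V y) = nm y by apply: nm_eq_dot; rewrite Vd.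
have : x = 0.
  apply: (nofix' i) => n; apply: (isometry_inj Vl Vn).
  by rewrite VD// Vx xi_fixed.
move=> x0; have := gns_norm (phi_state i) (gns i).
by rewrite -Vx Vn x0 nm0 => /esym/eqP; rewrite oner_eq0.
Qed.

Let U'_nm i y : nm (U' i y) = nm y.
Proof. by apply: nm_eq_dot; rewrite -UU' UK. Qed.

Let U_nm i y : nm (U i y) = nm y.
Proof. by apply: nm_eq_dot; rewrite UU' U'K. Qed.

(* Because (1 - q_N) U_i = s_N = s_N (1 - p_N). *)
Let U_fixed i x : fixed_space sg (p i) x -> fixed_space sg (p r) (U i x).
Proof.
move=> fx N; apply/esym/eqP; rewrite -subr_eq0; apply/eqP.
rewrite -{1}(proj2 sgr (U i x)) -(repB sgr).
apply: dot_injl => y; rewrite dot0l (rep_star sgrep) UU'.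
rewrite starB star1 (dp_star (p_proj r)) U'_cut -(rep_star sgrep).
by rewrite -(s_elt_right (chain i) (leqnn N)) (repM sgrep) (cut_fixed sgr)//
  (lin0 (rep_lin sgr _)) dot0l.
Qed.

Let U'_fixed i x : fixed_space sg (p r) x -> fixed_space sg (p i) (U' i x).
Proof.
move=> fx N; apply/esym/eqP; rewrite -subr_eq0; apply/eqP.
rewrite -{1}(proj2 sgr (U' i x)) -(repB sgr).
apply: dot_injl => y; rewrite dot0l (rep_star sgrep) (adjoint_sym (UU' i)).
rewrite starB star1 (dp_star (p_proj i)) U_cut -(adjoint_sym (rep_star sgrep _)).
rewrite s_elt_star -(s_elt_right (pic_star (chain i)) (leqnn N)) (repM sgrep).
by rewrite (cut_fixed sgr)// (lin0 (rep_lin sgr _)) dot0l.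
Qed.

(** From one fixed unit vector, the unitaries U i produce unit vectors eta_i
    fixed by the p_i and such that U i eta_i = eta_r.  They have the Gram matrix
    of the zeta_i under C, whence an isometry H -> K, which intertwines C and
    the L i, hence A. *)
Lemma irreducible_equiv_inclusion :
  unitarily_equivalent A rho (fun T : H -> H => T).
Proof.
have [j [x fx x0]] := exists_fixed.
have [y fy y1] := fixed_space_unit sgr fx x0.
pose eta_r := U j y; pose eta i := U' i eta_r.
have fr : fixed_space sg (p r) eta_r by exact: U_fixed.
have etaP i : fixed_space sg (p i) (eta i) /\ nm (eta i) = 1.
  by split; [exact: U'_fixed|rewrite U'_nm U_nm].
(* The vector eta r is the image of zeta r; U r = 1 makes it agree with the
   common value eta_r of the U i (eta i). *)
have eta_rE : eta r = eta_r by rewrite -[LHS]UrE UK.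
have zetaP i : fixed_space Pi (p i) (zeta i) /\ nm (zeta i) = 1 by [].
have [ia jb||W [Wl Wn Wh]] := @gram_isometry R H K (I * C)%type
    (fun ia => Pi ia.2 (zeta ia.1)) (fun ia => sg ia.2 (eta ia.1)).
- exact: (fixed_gram p_proj excision phi_state gns xi_fixed pi_classes).
- exact: (zeta_cyclic gns H_sum Pi_sum).
have Wt u l : tends u l -> tends (W \o u) (W l) by exact: isometry_tends.
have Wzeta i : W (zeta i) = eta i.
  by have := Wh (i, cone); rewrite /= (proj2 Pir) (proj2 sgr).
have WPi a v : W (Pi a v) = sg a (W v).
  move: v; apply: (zeta_ind gns H_sum Pi_sum).
  - move=> u v hu hv.
    by rewrite (linD (rep_lin Pir a)) !(linD Wl) hu hv (linD (rep_lin sgr a)).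
  - move=> u l hu ul; apply: (tends_uniq (Wt _ _ (rep_tends_vec Pir a ul))).
    rewrite (_ : _ \o _ = fun n => sg a (W (u n))); last exact: funext.
    by apply: (rep_tends_vec sgr); exact: Wt.
  - move=> i b; rewrite -(repM Pirep) (Wh (i, a ** b)) (Wh (i, b)) /=.
    by rewrite (repM sgrep).
  - by rewrite (lin0 (rep_lin Pir a)) (lin0 Wl) (lin0 (rep_lin sgr a)).
have WL i v : W (L i v) = U i (W v).
  apply: (cut_ext Pir (@pz i) (F := W \o L i) (G := U i \o W)).
  - by move=> c u u'; rewrite /= (proj1 (Lb i)) Wl.
  - by move=> c u u'; rewrite /= Wl (proj1 (Ub i)).
  - by move=> u l ul; apply: Wt; apply: bounded_tends (Lb i) ul.
  - by move=> u l ul; apply: (bounded_tends (Ub i)); apply: Wt.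
  - by move=> N u; rewrite /= L_cut_i !WPi U_cut.
  - by rewrite /= L_zeta !Wzeta /eta UK.
have WL' i v : W (L' i v) = U' i (W v).
  by rewrite -[LHS](U'K i) -WL LK.
have WT T v : A T -> W (T v) = rho T (W v).
  move=> AT.
  have [||||||T' [_ _ h _]] := @generated_ind _ _ (range Pi `|` range L)
    (fun T => forall v, W (T v) = rho T (W v)) _ _ _ _ _ _ T AT; last exact: h.
  - move=> _ [[a _ <-]|[i _ <-]].
      exists (Pi (star a)); split; try exact: (rep_bounded Pirep).
        exact: (rep_star Pirep).
      by split=> u; apply: WPi.
    by exists (L' i); split.
  - by move=> u; rewrite rho0 (lin0 Wl).
  - by move=> S1 S2 AS1 AS2 h1 h2 u; rewrite (oprepD rhor AS1 AS2) (linD Wl) h1 h2.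
  - by move=> c S1 AS1 h1 u; rewrite (oprepZ rhor _ AS1) (linZ Wl) h1.
  - by move=> S1 S2 AS1 AS2 h1 h2 u; rewrite (oprepM rhor AS1 AS2) /= h1 h2.
  - move=> S1 Sn AS1 hSn hlim u.
    have ASn n : A (Sn n) by have [] := hSn n.
    apply/esym/(tends_uniq (rho_tends (W u) AS1 ASn hlim)).
    have := Wt (fun n => Sn n u) (S1 u).
    rewrite (_ : W \o _ = fun n => rho (Sn n) (W u)); last first.
      by apply: funext => n /=; have [_] := hSn n.
    apply; apply: (tends_harmonic (nm_ge0 u)) => n.
    by rewrite nm_distC.
have Ws : range W = setT.
  have [||||h|//] := @rho_irr (range W).
  - exact: isometry_range_closed.
  - by exists 0 => //; rewrite (lin0 Wl).
  - by move=> c _ _ [u _ <-] [u' _ <-]; exists (c *: u + u') => //; rewrite Wl.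
  - by move=> T _ AT [u _ <-]; exists (T u) => //; rewrite WT.
  have : [set 0] (eta j) by rewrite -h; exists (zeta j).
  by move=> /= e0; have [_] := etaP j; rewrite e0 nm0 => /esym/eqP; rewrite oner_eq0.
apply: unitary_inverse; exists W => [|T v AT]; last exact: WT.
by split=> //; exact: isometry_dot.
Qed.

End InclusionUnique.

Theorem theorem4p1 (R : realType)
  (C : cstarAlgType R) (iota : forall n, 'M[R[i]]_(dimC n) -> C)
  (C_car : CAR_algebra iota)
  (I : Type) (r : I) (phi : I -> C -> R[i])
  (phi_pure : forall i, pure_state (phi i))
  (phi_r : first_coordinate_state iota (phi r))
  (Hs : I -> hilbertType R) (pi : forall i, C -> Hs i -> Hs i)
  (xi : forall i, Hs i)
  (gns : forall i, GNS_triple (phi i) (pi i) (xi i))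
  (pi_classes : forall (K : hilbertType R) (sigma : C -> K -> K),
    representation sigma -> nonzero_rep setT sigma ->
    irreducible_rep setT sigma ->
    exists! i, unitarily_equivalent setT sigma (pi i))
  (alpha : I -> C -> C)
  (alpha_aut : forall i, automorphism (alpha i))
  (phi_alpha : forall i, phi i \o alpha i = phi r)
  (alpha_r : alpha r = id)
  (alpha_inner : forall i, asymptotically_inner (alpha i))
  (w : I -> nat -> C)
  (w_source : forall i n, star (w i n) ** w i n =
    alpha i (q_proj iota n) - alpha i (q_proj iota n.+1))
  (w_range : forall i n, w i n ** star (w i n) = f_proj iota n)
  (w_r : forall n, w r n = f_proj iota n)
  (H : hilbertType R) (inc : forall i, Hs i -> H)
  (H_sum : hilbert_sum inc)
  (Pi : C -> H -> H)
  (Pi_sum : forall a, operator_sum inc (fun i => pi i a) (Pi a)) :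
  let L := fun i => L_op Pi (w i) (inc r (xi r)) (inc i (xi i)) in
  let A := cstar_generated (range Pi `|` range L) in
  forall (K : hilbertType R) (rho : (H -> H) -> (K -> K)),
    op_representation A rho -> nonzero_rep A rho -> irreducible_rep A rho ->
    unitarily_equivalent A rho (fun T : H -> H => T).
Proof.
pose p i := alpha i \o q_proj iota.
have p_r n : p r n = q_proj iota n by rewrite /p alpha_r.
have qd := q_proj_decreasing C_car.
have pd i : decreasing_projections (p i) by exact: automorphism_projections.
have phis i : state (phi i) by have [] := phi_pure i.
have pir i := gns_unital (gns i).
have xi_fixed i : fixed_space (pi i) (p i) (xi i).
  apply: (fixed_space_of_norm1 (pir i) (pd i) (gns_norm (phis i) (gns i))) => n.
  have [_ _ <-] := gns i.
  by rewrite -[phi i _]/((phi i \o alpha i) _) phi_alpha first_coordinate_q.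
apply: (irreducible_equiv_inclusion (phi := phi) (p := p)) => //.
- move=> K sg sgr i x y a; exact: (automorphism_excision C_car _ phi_r (gns r)).
- move=> i; split=> //.
  + by rewrite /p /= q_proj0// automorphism_unital.
  + by rewrite p_r q_proj0.
  + by move=> n; rewrite w_range !p_r.
- by move=> n; rewrite w_r !p_r.
Qed.
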